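(* Let $D\subset\mathbb R^2$ be a bounded domain such that for every continuous $g:\partial D\to\mathbb R$ there is $u_g\in C^2(D)\cap C(\overline D)$ with $\Delta u_g=0$ on $D$ and $u_g=g$ on $\partial D$, and for $x\in D$ let $I_x(g):=u_g(x)$ on $C(\partial D)$. Let $\mathcal L_x$ and $\int_x$ be the class of integrable functions and Daniell integral on $\partial D$ obtained from the $I$-integral $I_x$. If $f\in\mathcal L_x$ for some $x\in D$, then $f\in\mathcal L_y$ for every $y\in D$, and the function $v_f:D\to\mathbb R$, $v_f(y):=\int_y f$, is harmonic on $D$.
   Context: $\Delta u=\partial_1^2u+\partial_2^2u$; a function is harmonic on an open set if it is $C^2$ there with $\Delta u=0$. A domain is a connected open set. $\overline{\mathbb R}=\mathbb R\cup\{\pm\infty\}$. For each $x\in D$, $I_x$ is an $I$-integral on $C(\partial D)$ (linear, positive, and $I_x(g_n)\to0$ whenever $g_n\searrow0$ pointwise). The Daniell extension: $T_1$ is the set of functions $\partial D\to\overline{\mathbb R}$ that are pointwise limits of pointwise nondecreasing sequences $(g_n)\subset C(\partial D)$; $I_{1,x}(\varphi):=\lim_n I_x(g_n)\in\mathbb R\cup\{\infty\}$ for such a sequence (independent of choice); $\overline I_x(f):=\inf\{I_{1,x}(\varphi):\varphi\in T_1,\ \varphi\ge f\}$ (with $\inf\emptyset=+\infty$), $\underline I_x(f):=-\overline I_x(-f)$; $\mathcal L_x:=\{f:\partial D\to\overline{\mathbb R}\,:\ \overline I_x(f)=\underline I_x(f)\in\mathbb R\}$ and $\int_x f$ is the common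 value. *)

(* Defs.v *)
From HB Require Import structures.
From mathcomp Require Import all_boot all_order all_algebra.
From mathcomp Require Import all_classical all_reals all_analysis.
Set Implicit Arguments. Unset Strict Implicit. Unset Printing Implicit Defensive.
Import Order.TTheory GRing.Theory Num.Theory.
Import numFieldTopology.Exports numFieldNormedType.Exports.
Local Open Scope classical_set_scope.
Local Open Scope ring_scope.

Section PilotDefs.
Context {R : realType}.
Local Notation P := (R * R)%type.

(* boundary of an open set D : closure D minus D (= closure minus interior) *)
Definition bdry (D : set P) : set P := closure D `\` D.

Definition partial1 (u : P -> R) (x : P) : R := derive1 (fun t => u (t, x.2)) x.1.
Definition partial2 (u : P -> R) (x : P) : R := derive1 (fun t => u (x.1, t)) x.2.
Definition has_partial1 (u : P -> R) (x : P) : Prop :=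
  derivable (fun t => u (t, x.2)) x.1 1.
Definition has_partial2 (u : P -> R) (x : P) : Prop :=
  derivable (fun t => u (x.1, t)) x.2 1.

Definition C1_on (D : set P) (u : P -> R) : Prop :=
  {in D, continuous u} /\
  (forall x, D x -> has_partial1 u x /\ has_partial2 u x) /\
  {in D, continuous (partial1 u)} /\ {in D, continuous (partial2 u)}.

Definition C2_on (D : set P) (u : P -> R) : Prop :=
  C1_on D u /\ C1_on D (partial1 u) /\ C1_on D (partial2 u).

Definition laplacian (u : P -> R) (x : P) : R :=
  partial1 (partial1 u) x + partial2 (partial2 u) x.

Definition harmonic_on (D : set P) (u : P -> R) : Prop :=
  C2_on D u /\ forall x, D x -> laplacian u x = 0.

(* g : boundary D -> R continuous (only values on the boundary matter) *)
Definition Cbd (D : set P) (g : P -> R) : Prop := {within bdry D, continuous g}.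

Definition dirichlet_sol (D : set P) (g : P -> R) (u : P -> R) : Prop :=
  harmonic_on D u /\ {within closure D, continuous u} /\
  forall y, bdry D y -> u y = g y.

Definition incr_seq (D : set P) (g : nat -> P -> R) : Prop :=
  (forall n, Cbd D (g n)) /\ forall n y, bdry D y -> g n y <= g n.+1 y.

(* Daniell upper integral: inf of I_1(phi) = lim I(g_n) over phi in T_1, phi >= f
   (phi = pointwise limit of the nondecreasing sequence (g_n) in C(boundary D)) *)
Definition upper_int (D : set P) (I : (P -> R) -> R) (f : P -> \bar R) : \bar R :=
  ereal_inf [set l | exists (g : nat -> P -> R) (phi : P -> \bar R),
    [/\ incr_seq D g,
        (forall y, bdry D y -> (fun n => (g n y)%:E) @ \oo --> phi y),
        (forall y, bdry D y -> (f y <= phi y)%E) &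
        l = limn (fun n => (I (g n))%:E)]].

Definition lower_int (D : set P) (I : (P -> R) -> R) (f : P -> \bar R) : \bar R :=
  (- upper_int D I (fun y => - f y))%E.

Definition integrable_D (D : set P) (I : (P -> R) -> R) (f : P -> \bar R) : Prop :=
  exists r : R, upper_int D I f = r%:E /\ lower_int D I f = r%:E.

(* the Daniell integral of f (meaningful when f is integrable) *)
Definition daniell (D : set P) (I : (P -> R) -> R) (f : P -> \bar R) : R :=
  fine (upper_int D I f).

End PilotDefs.

(* Main.v *)
(* The proof rests on the maximum principle alone; no integral representation is
   used. A comparison argument bounds the first differences of a harmonic function
   by its supremum; applied to difference quotients it bounds second derivatives, so
   locally uniform limits of harmonic functions are harmonic. Maximizing [u] against
   a weight that vanishes on the boundary of a ball, and comparing with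
   [1 / |z - p|^2] around the maximum [p], gives Harnack's inequality, which
   propagates over the connected set [D]; monotone limits of harmonic functions that
   are finite at one point are therefore harmonic.

   If [f] is integrable at [x], choose [g_k] increasing to a majorant of [f] and [h_k]
   increasing to a majorant of [- f] with [lim U g_k x + lim U h_k x] small. The limits
   [a = lim U g_k] and [b = lim U h_k] are harmonic on [D] and, on [D],
   [- b <= lower integral of f <= upper integral of f <= a], where the middle
   inequality is Dini's theorem on the compact boundary. By Harnack [a + b >= 0] is
   small locally uniformly, so the two integrals coincide and are a locally uniform
   limit of harmonic functions. *)

From Pilot Require Import Defs.
From HB Require Import structures.
From mathcomp Require Import all_boot all_order all_algebra.
From mathcomp Require Import all_classical all_reals all_analysis.
From mathcomp Require Import ring lra.
Import Order.TTheory GRing.Theory Num.Theory.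
Import numFieldTopology.Exports numFieldNormedType.Exports.
Local Open Scope classical_set_scope.
Local Open Scope ring_scope.

Set Implicit Arguments.
Unset Strict Implicit.
Unset Printing Implicit Defensive.

Local Notation cball := (closed_ball_ Num.norm).

Section NormedModules.
Context {R : realType} {V : normedModType R}.
Implicit Types (x y v : V) (r s : R).

Lemma nbhs_ball_mem x y r : ball x r y -> nbhs y (ball x r).
Proof. by move=> xy; apply: open_nbhs_nbhs; split=> //; exact: ball_open. Qed.

Lemma cball_center x r : 0 <= r -> cball x r x.
Proof. by rewrite /closed_ball_ /= subrr normr0. Qed.

Lemma cball_sub_ball x y r s : `|x - y| < r - s -> cball y s `<=` ball x r.
Proof.
move=> xy z yz; rewrite -ball_normE /ball_ /=.
by have := ler_distD y x z; rewrite /closed_ball_ /= in yz; lra.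
Qed.

Lemma ball_sub_ball x y r s : `|x - y| <= r - s -> ball y s `<=` ball x r.
Proof.
move=> xy z; rewrite -!ball_normE /ball_ /= => yz.
by have := ler_distD y x z; lra.
Qed.

Lemma continuous_dist x : continuous (fun y => `|x - y|).
Proof. by move=> y; exact: cvg_norm (cvgB (cvg_cst x) cvg_id). Qed.

Lemma cvg_line x v : x + t *: v @[t --> (0 : R)] --> x.
Proof.
rewrite -[X in _ --> X]addr0 -(scale0r v).
exact: cvgD (cvg_cst x) (cvgZ cvg_id (cvg_cst v)).
Qed.

Lemma near0_norm_scale_lt v r : 0 < r -> \forall t \near (0 : R)^', `|t *: v| < r.
Proof.
move=> r_gt0; apply: cvg_within.
have := @cvg_line 0 v; under eq_fun do rewrite add0r.
by move=> /cvgr0Pnorm_lt; exact.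
Qed.

End NormedModules.

Section Plane.
Context {R : realType}.
Local Notation P := (R * R)%type.
Implicit Types (x y z : P) (A : set P).

Lemma prod_norm_le {U V : normedModType R} (x : U * V) (r : R) :
  (`|x| <= r) = (`|x.1| <= r) && (`|x.2| <= r).
Proof. by rewrite prod_normE ge_max. Qed.

Lemma prod_norm_lt {U V : normedModType R} (x : U * V) (r : R) :
  (`|x| < r) = (`|x.1| < r) && (`|x.2| < r).
Proof. by rewrite prod_normE gt_max. Qed.

Lemma compact_cball x (r : R) : compact (cball x r).
Proof.
have -> : cball x r = [set` `[x.1 - r, x.1 + r]] `*` [set` `[x.2 - r, x.2 + r]].
  by apply/seteqP; split=> z; rewrite /closed_ball_ /= prod_norm_le /= !in_itv /=
    -!ler_distlC => /andP.
by apply: compact_setX; exact: segment_compact.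
Qed.

Lemma compact_annulus x (r s : R) : compact [set y | r <= `|x - y| <= s].
Proof.
apply: subclosed_compact (@compact_cball x s) _ => [|y /andP[]//].
apply: (@preimage_closed _ _ (fun y => `|x - y|) [set` `[r, s]]).
  by move=> y _; exact: continuous_dist.
exact: interval_closed.
Qed.

Lemma nbhs_rectangle (a b c d : R) z : a < z.1 < b -> c < z.2 < d ->
  nbhs z ([set` `[a, b]] `*` [set` `[c, d]]).
Proof.
move=> z1 z2; exists ([set` `]a, b[], [set` `]c, d[]) => /= [|y [y1 y2]].
  by split; apply: near_in_itvoo; rewrite in_itv.
by split; exact: subset_itv_oo_cc.
Qed.

Lemma near_cross x A : nbhs x A -> \forall s \near (0 : R)^'+,
  [/\ A (x.1 + s, x.2), A (x.1 - s, x.2), A (x.1, x.2 + s) & A (x.1, x.2 - s)].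
Proof.
move=> /nbhs_ballP[r r_gt0 xrA]; near=> s.
have s_lt_r : s < r by near: s; exact: nbhs_right_lt.
have s_gt0 : 0 < s by near: s; exact: nbhs_right_gt.
by split; apply: xrA; rewrite -ball_normE /ball_ /= prod_norm_lt /= ?subrr ?normr0
  ?opprD ?opprK ?addNKr ?addrA ?subrr ?add0r ?normrN ?gtr0_norm ?r_gt0 ?s_lt_r.
Unshelve. all: by end_near. Qed.

End Plane.

Section GeneralizedLaplacian.
Context {R : realType}.
Local Notation P := (R * R)%type.
Implicit Types (u v : P -> R) (x : P) (l m c : R).

Definition five_point u x (s : R) : R :=
  u (x.1 + s, x.2) + u (x.1 - s, x.2) + u (x.1, x.2 + s) + u (x.1, x.2 - s)
  - 4 * u x.

(* Unlike the second partial derivatives, this limit passes to translates,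
   reflections and differences at once, and it is nonpositive at a maximum. Since
   [five_point] is even in [s], a one-sided limit suffices. *)
Definition has_laplacian u x l : Prop :=
  s ^- 2 * five_point u x s @[s --> 0^'+] --> l.

Lemma has_laplacianD u v x l m :
  has_laplacian u x l -> has_laplacian v x m -> has_laplacian (u + v) x (l + m).
Proof.
move=> ul vm; apply: cvg_trans (cvgD ul vm); apply: near_eq_cvg.
by apply: nearW => s; rewrite /five_point !fctE /=; ring.
Qed.

Lemma has_laplacianZ c u x l :
  has_laplacian u x l -> has_laplacian (c *: u) x (c * l).
Proof.
move=> ul; apply: cvg_trans (cvgM (cvg_cst c) ul); apply: near_eq_cvg.
by apply: nearW => s; rewrite /five_point !fctE /GRing.scale /=; ring.
Qed.

Lemma has_laplacianN u x l : has_laplacian u x l -> has_laplacian (- u) x (- l).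
Proof. by move=> /(has_laplacianZ (c := -1)); rewrite scaleN1r mulN1r. Qed.

Lemma has_laplacianB u v x l m :
  has_laplacian u x l -> has_laplacian v x m -> has_laplacian (u - v) x (l - m).
Proof. by move=> ul /has_laplacianN; exact: has_laplacianD. Qed.

Lemma has_laplacian_quadratic u x l :
  (forall s, five_point u x s = l * s ^+ 2) -> has_laplacian u x l.
Proof.
move=> ul; apply: cvg_near_cst; near=> s.
by rewrite ul mulrCA mulVf ?mulr1 // expf_neq0.
Unshelve. all: by end_near. Qed.

Lemma has_laplacian_cst c x : has_laplacian (cst c) x 0.
Proof. by apply: has_laplacian_quadratic => s; rewrite /five_point /=; ring. Qed.

Lemma max_has_laplacian_le0 u x l :
  (\forall z \near x, u z <= u x) -> has_laplacian u x l -> l <= 0.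
Proof.
move=> /near_cross u_max ul; rewrite leNgt; apply/negP => /(cvgr_gt l ul) l_gt0.
near (0 : R)^'+ => s.
have [] : [/\ u (x.1 + s, x.2) <= u x, u (x.1 - s, x.2) <= u x,
    u (x.1, x.2 + s) <= u x & u (x.1, x.2 - s) <= u x] by near: s.
have : 0 < s ^- 2 * five_point u x s by near: s.
by rewrite pmulr_rgt0 ?invr_gt0 ?exprn_gt0 // /five_point; lra.
Unshelve. all: by end_near. Qed.

End GeneralizedLaplacian.

Section MaximumPrinciple.
Context {R : realType}.
Local Notation P := (R * R)%type.
Implicit Types (w : P -> R) (x : P) (K : set P) (m l : R).

Lemma max_principle_strict K w m : compact K -> {within K, continuous w} ->
  (forall x, K x -> w x <= m \/ K^° x /\ exists2 l, 0 < l & has_laplacian w x l) ->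
  forall x, K x -> w x <= m.
Proof.
move=> cK cw w_le x Kx.
have [p /set_mem Kp p_max] := compact_EVT_max (ex_intro _ x Kx) cK cw.
apply: (le_trans (p_max _ (mem_set Kx))).
have [//|[intKp [l l_gt0 wl]]] := w_le _ Kp.
suff : l <= 0 by rewrite leNgt l_gt0.
apply: max_has_laplacian_le0 wl; apply: filterS intKp => z Kz.
exact/p_max/mem_set.
Qed.

Lemma max_principle K w m : compact K -> {within K, continuous w} ->
  (forall x, K x -> w x <= m \/ K^° x /\ exists2 l, 0 <= l & has_laplacian w x l) ->
  forall x, K x -> w x <= m.
Proof.
move=> cK cw w_le x Kx; pose q := fun z : P => z.1 ^+ 2.
have cq : continuous q by move=> z; apply: cvgM; exact: cvg_fst.
have ql z : has_laplacian q z 2.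
  by apply: has_laplacian_quadratic => s; rewrite /five_point /q /=; ring.
have [p _ q_le] := compact_EVT_max (ex_intro _ x Kx) cK (continuous_subspaceT cq).
apply/ler_addgt0Pr => e e_gt0; pose d := e / (q p + 1).
have qp_ge0 : 0 <= q p by exact: sqr_ge0.
have d_gt0 : 0 < d by rewrite divr_gt0 // ltr_wpDl.
have dq_le : d * q p <= e by rewrite mulrAC ler_pdivrMr ?ltr_wpDl // ler_pM2l // lerDl.
suff : (w + d *: q) x <= m + e.
  by apply: le_trans; rewrite lerDl mulr_ge0 ?sqr_ge0 // ltW.
apply: (max_principle_strict cK) Kx => [|z Kz].
  apply: within_continuousD => //; apply: continuous_subspaceT => z.
  exact: (cvgM (cvg_cst d) (cq z)).
have [w_le_m|[intKz [l l_ge0 wl]]] := w_le _ Kz; [left|right; split => //].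
  by apply: lerD => //; apply: le_trans dq_le; rewrite ler_pM2l // q_le ?inE.
by exists (l + d * 2); [lra|exact: has_laplacianD (has_laplacianZ (ql z))].
Qed.

End MaximumPrinciple.

Section WeakHarmonic.
Context {R : realType}.
Local Notation P := (R * R)%type.
Implicit Types (u v : P -> R) (x : P) (D : set P).

Definition weak_harmonic D u : Prop :=
  forall x, D x -> {for x, continuous u} /\ has_laplacian u x 0.

Lemma weak_harmonicD D u v :
  weak_harmonic D u -> weak_harmonic D v -> weak_harmonic D (u + v).
Proof.
move=> hu hv x Dx; have [cu lu] := hu _ Dx; have [cv lv] := hv _ Dx.
by split; [exact: cvgD|rewrite -[0]addr0; exact: has_laplacianD].
Qed.

Lemma weak_harmonicZ (c : R) D u : weak_harmonic D u -> weak_harmonic D (c *: u).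
Proof.
move=> hu x Dx; have [cu lu] := hu _ Dx.
split; first exact: cvgM (cvg_cst c) cu.
by rewrite -(mulr0 c); exact: has_laplacianZ.
Qed.

Lemma weak_harmonicN D u : weak_harmonic D u -> weak_harmonic D (- u).
Proof. by rewrite -scaleN1r; exact: weak_harmonicZ. Qed.

Lemma weak_harmonicB D u v :
  weak_harmonic D u -> weak_harmonic D v -> weak_harmonic D (u - v).
Proof. by move=> hu /weak_harmonicN; exact: weak_harmonicD. Qed.

Lemma sub_weak_harmonic D D' u :
  D' `<=` D -> weak_harmonic D u -> weak_harmonic D' u.
Proof. by move=> D'D hu x /D'D /hu. Qed.

Lemma weak_harmonic_comp (phi : P -> P) D u : continuous phi ->
  (forall x s, five_point (u \o phi) x s = five_point u (phi x) s) ->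
  weak_harmonic D u -> weak_harmonic (phi @^-1` D) (u \o phi).
Proof.
move=> cphi phiE hu x /hu[cu lu]; split; first exact: continuous_comp (cphi x) cu.
by rewrite /has_laplacian (_ : five_point _ x = five_point u (phi x)) //; apply/funext.
Qed.

Lemma weak_harmonic_shift (a : P) D u :
  weak_harmonic D u -> weak_harmonic (+%R^~ a @^-1` D) (u \o +%R^~ a).
Proof.
apply: weak_harmonic_comp => [z|x s]; first by apply: cvgD; [|exact: cvg_cst].
have addE (y z : P) : y + z = (y.1 + z.1, y.2 + z.2) by [].
by rewrite /five_point /= !addE /= ![_ + _ + a.1]addrAC ![_ + _ + a.2]addrAC.
Qed.

Lemma weak_harmonic_reflect (a : R) D u : weak_harmonic D u ->
  weak_harmonic ((fun z => (z.1, a - z.2)) @^-1` D) (u \o (fun z => (z.1, a - z.2))).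
Proof.
apply: weak_harmonic_comp => [z|x s].
  exact: cvg_pair cvg_fst (cvgB (cvg_cst a) cvg_snd).
by rewrite /five_point /= !opprD !opprK !addrA; ring.
Qed.

Lemma weak_harmonic_swap D u : weak_harmonic D u ->
  weak_harmonic ((fun z => (z.2, z.1)) @^-1` D) (u \o (fun z => (z.2, z.1))).
Proof.
apply: weak_harmonic_comp => [z|x s]; last by rewrite /five_point /=; ring.
exact: cvg_pair cvg_snd cvg_fst.
Qed.

End WeakHarmonic.

Section InteriorEstimates.
Context {R : realType}.
Local Notation P := (R * R)%type.
Implicit Types (u w : P -> R) (x y z v : P) (d M t : R).

Definition axis_barrier x d z : R :=
  d ^+ 2 + (z.1 - x.1) ^+ 2 - (x.2 + d - z.2) ^+ 2.

Lemma weak_harmonic_axis_barrier x d (D : set P) : weak_harmonic D (axis_barrier x d).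
Proof.
move=> z _; split; last first.
  by apply: has_laplacian_quadratic => s; rewrite /five_point /axis_barrier /=; ring.
have cvg1 : (fun y : P => y.1 - x.1) @ z --> z.1 - x.1.
  exact: cvgB cvg_fst (cvg_cst x.1).
have cvg2 : (fun y : P => x.2 + d - y.2) @ z --> x.2 + d - z.2.
  exact: cvgB (cvg_cst (x.2 + d)) cvg_snd.
exact: cvgB (cvgD (cvg_cst (d ^+ 2)) (cvgM cvg1 cvg1)) (cvgM cvg2 cvg2).
Qed.

Lemma axis_barrier_ge0 x d z : z.2 = x.2 -> 0 <= axis_barrier x d z.
Proof.
move=> z2; rewrite /axis_barrier z2 [x.2 + d]addrC addrK addrAC subrr add0r.
exact: sqr_ge0.
Qed.

Lemma axis_barrier_ge_sqr x d z : `|x.2 + d - z.2| <= `|z.1 - x.1| ->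
  d ^+ 2 <= axis_barrier x d z.
Proof.
move=> z_le; rewrite /axis_barrier -addrA lerDl subr_ge0.
by rewrite -[leLHS]real_normK ?num_real // -[leRHS]real_normK ?num_real // ler_sqr.
Qed.

Lemma half_square_le w x d M t : 0 < d -> 0 <= M ->
  let K := [set` `[x.1 - d, x.1 + d]] `*` [set` `[x.2, x.2 + d]] in
  weak_harmonic K w -> (forall z, K z -> w z <= M) ->
  (forall z, K z -> z.2 = x.2 -> w z <= 0) ->
  0 <= t <= d -> w (x.1, x.2 + t) <= 2 * M / d * t.
Proof.
move=> d_gt0 M_ge0 K hw w_le_M w_le0 /andP[t_ge0 t_le_d].
pose c := M / d ^+ 2; pose b := axis_barrier x d.
have d2_gt0 : 0 < d ^+ 2 by rewrite exprn_gt0.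
have c_ge0 : 0 <= c by rewrite divr_ge0 // ltW.
have hwb : weak_harmonic K (w - c *: b).
  apply: (weak_harmonicB hw); apply: weak_harmonicZ; exact: weak_harmonic_axis_barrier.
have wb_le0 z : K z -> d ^+ 2 <= b z -> (w - c *: b) z <= 0.
  move=> /w_le_M wM /(ler_wpM2l c_ge0); rewrite divfK ?gt_eqF // => Mb.
  by rewrite subr_le0 (le_trans wM).
have : (w - c *: b) (x.1, x.2 + t) <= 0.
  apply: (@max_principle _ K).
  - by apply: compact_setX; exact: segment_compact.
  - by apply: continuous_in_subspaceT => z /set_mem /hwb[].
  - move=> z Kz; have [/=] := Kz; rewrite !in_itv /= => z1 z2.
    have [/axis_barrier_ge_sqr|z_lt] := leP `|x.2 + d - z.2| `|z.1 - x.1|.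
      by left; exact: wb_le0.
    have [z2_eq|z2_neq] := eqVneq z.2 x.2.
      left; rewrite subr_le0 (le_trans (w_le0 _ Kz z2_eq)) // mulr_ge0 //.
      exact: axis_barrier_ge0.
    have z2_gt : x.2 < z.2 by rewrite lt_neqAle eq_sym z2_neq; case/andP: z2.
    have d_ge : `|x.2 + d - z.2| = x.2 + d - z.2 by rewrite ger0_norm; lra.
    have z2_lt : 0 < x.2 + d - z.2 by rewrite -d_ge (le_lt_trans _ z_lt).
    right; split; last by exists 0 => //; exact: (hwb _ Kz).2.
    apply: nbhs_rectangle; last by apply/andP; split; lra.
    by rewrite -ltr_distl (lt_le_trans z_lt) // d_ge; lra.
  by split; rewrite /= in_itv /=; lra.
rewrite subr_le0 => /le_trans; apply.
have -> : 2 * M / d * t = c * (2 * d * t) by rewrite /c; field; rewrite gt_eqF.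
apply: ler_wpM2l => //; rewrite /b /axis_barrier /=.
have := sqr_ge0 t; lra.
Qed.

Lemma vertical_symmetric_difference_le u x d M t : 0 < d ->
  weak_harmonic (cball x d) u ->
  (forall z, cball x d z -> `|u z| <= M) ->
  0 <= t <= d -> u (x.1, x.2 + t) - u (x.1, x.2 - t) <= 4 * M / d * t.
Proof.
move=> d_gt0 hu u_le t_le; pose r z : P := (z.1, 2 * x.2 - z.2).
pose K := [set` `[x.1 - d, x.1 + d]] `*` [set` `[x.2, x.2 + d]].
have Kball z : K z -> cball x d z.
  by move=> [/=]; rewrite !in_itv /closed_ball_ /= prod_norm_le /= !ler_distl; lra.
have Kreflect z : K z -> cball x d (r z).
  by move=> [/=]; rewrite !in_itv /closed_ball_ /= prod_norm_le /= !ler_distl; lra.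
have M_ge0 : 0 <= M.
  exact: le_trans (normr_ge0 (u x)) (u_le _ (cball_center x (ltW d_gt0))).
have -> : u (x.1, x.2 + t) - u (x.1, x.2 - t) = (u - (u \o r)) (x.1, x.2 + t).
  by congr (_ - u (_, _)); rewrite /=; ring.
have -> : 4 * M / d * t = 2 * (2 * M) / d * t by ring.
apply: half_square_le => //; first exact: mulr_ge0.
- apply: weak_harmonicB; first exact: sub_weak_harmonic hu.
  exact: sub_weak_harmonic (weak_harmonic_reflect hu).
- move=> z Kz; have := u_le _ (Kball _ Kz); have := u_le _ (Kreflect _ Kz).
  by rewrite !ler_norml -[(u - (u \o r)) z]/(u z - u (r z)); lra.
move=> z _ z2; rewrite -[(u - (u \o r)) z]/(u z - u (r z)).
suff -> : r z = z by rewrite subrr.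
by rewrite [RHS]surjective_pairing /r z2; congr pair; ring.
Qed.

Lemma vertical_lipschitz u x d M (a b c : R) : 0 < d ->
  weak_harmonic (ball x d) u -> (forall z, ball x d z -> `|u z| <= M) ->
  ball x (d / 2) (a, b) -> ball x (d / 2) (a, c) ->
  `|u (a, b) - u (a, c)| <= 4 * M / d * `|b - c|.
Proof.
move=> d_gt0 hu u_le xab xac.
wlog c_le_b : b c xab xac / c <= b.
  move=> le_case; have [|/ltW] := leP c b; first exact: le_case.
  by rewrite distrC [`|b - c|]distrC; exact: le_case.
pose p : P := (a, (b + c) / 2); pose t := (b - c) / 2.
have d2_gt0 : 0 < d / 2 by rewrite divr_gt0.
have pd : cball p (d / 2) `<=` ball x d.
  apply: cball_sub_ball; move: xab xac.
  by rewrite -!ball_normE /ball_ /= !prod_norm_lt /= !ltr_distl; lra.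
have t_le : 0 <= t <= d / 2.
  move: xab xac; rewrite -!ball_normE /ball_ /= !prod_norm_lt /= !ltr_distl /t.
  by lra.
have le_of w : weak_harmonic (ball x d) w -> (forall z, ball x d z -> `|w z| <= M) ->
    w (a, b) - w (a, c) <= 4 * M / d * (b - c).
  move=> hw w_le; have := vertical_symmetric_difference_le d2_gt0
    (sub_weak_harmonic pd hw) (fun z pz => w_le _ (pd _ pz)) t_le.
  rewrite /p /t /= (_ : (b + c) / 2 + (b - c) / 2 = b); last by field.
  rewrite (_ : (b + c) / 2 - (b - c) / 2 = c); last by field.
  by rewrite (_ : 4 * M / (d / 2) * ((b - c) / 2) = 4 * M / d * (b - c)) //; field;
    rewrite gt_eqF.
rewrite [`|b - c|]ger0_norm ?subr_ge0 // ler_norml le_of // andbT lerNl opprB.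
have := le_of _ (weak_harmonicN hu); rewrite !fctE opprK addrC; apply => z /u_le.
by rewrite normrN.
Qed.

Lemma weak_harmonic_lipschitz u x d M y z : 0 < d ->
  weak_harmonic (ball x d) u -> (forall z, ball x d z -> `|u z| <= M) ->
  ball x (d / 2) y -> ball x (d / 2) z ->
  `|u y - u z| <= 8 * M / d * `|y - z|.
Proof.
move=> d_gt0 hu u_le xy xz; pose s (z : P) : P := (z.2, z.1).
have ball_swap r p q : ball p r q -> ball (s p) r (s q).
  by rewrite -!ball_normE /ball_ /= !prod_norm_lt andbC.
have xyz : ball x (d / 2) (y.1, z.2).
  move: xy xz; rewrite -!ball_normE /ball_ /= !prod_norm_lt /=.
  by move=> /andP[-> _] /andP[_ ->].
have M_ge0 : 0 <= M.
  exact: le_trans (normr_ge0 (u x)) (u_le _ (ballxx x d_gt0)).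
have c_ge0 : 0 <= 4 * M / d by rewrite divr_ge0 ?mulr_ge0 // ltW.
have [y1_le y2_le] : `|y.1 - z.1| <= `|y - z| /\ `|y.2 - z.2| <= `|y - z|.
  by apply/andP; rewrite -(prod_norm_le (y - z)).
have vert : `|u y - u (y.1, z.2)| <= 4 * M / d * `|y.2 - z.2|.
  have := @vertical_lipschitz u x d M y.1 y.2 z.2 d_gt0 hu u_le.
  by rewrite -surjective_pairing; exact.
have hor : `|u (y.1, z.2) - u z| <= 4 * M / d * `|y.1 - z.1|.
  have := @vertical_lipschitz (u \o s) (s x) d M z.2 y.1 z.1 d_gt0.
  rewrite /s /= -surjective_pairing; apply.
  - by apply: sub_weak_harmonic (weak_harmonic_swap hu) => p; exact: ball_swap.
  - by move=> p /ball_swap; rewrite /s /= -surjective_pairing => /u_le.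
  - exact: (ball_swap _ _ (y.1, z.2)).
  - exact: ball_swap.
apply: (le_trans (ler_distD (u (y.1, z.2)) _ _)).
have := ler_wpM2l c_ge0 y1_le; have := ler_wpM2l c_ge0 y2_le.
have -> : 8 * M / d = 4 * M / d + 4 * M / d by field; rewrite gt_eqF.
by rewrite mulrDl; lra.
Qed.

Lemma weak_harmonic_double_difference_le u x d M y z v : 0 < d ->
  weak_harmonic (ball x d) u -> (forall z, ball x d z -> `|u z| <= M) ->
  `|v| < d / 4 -> ball x (d / 8) y -> ball x (d / 8) z ->
  `|u (y + v) - u y - (u (z + v) - u z)| <= 256 * M / d ^+ 2 * `|v| * `|y - z|.
Proof.
move=> d_gt0 hu u_le v_lt xy xz; pose w := u \o +%R^~ v - u.
have d4_gt0 : 0 < d / 4 by rewrite divr_gt0.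
have in_half p : ball x (d / 4) p -> ball x (d / 2) p /\ ball x (d / 2) (p + v).
  rewrite -!ball_normE /ball_ /= => xp; split; first by lra.
  by rewrite opprD addrA; have := ler_normB (x - p) v; lra.
have half_sub : ball x (d / 2) `<=` ball x d by apply: le_ball; lra.
have hw : weak_harmonic (ball x (d / 4)) w.
  apply: weak_harmonicB.
    by apply: sub_weak_harmonic (weak_harmonic_shift hu) => p /in_half[_ /half_sub].
  by apply: sub_weak_harmonic hu => p /in_half[/half_sub].
have w_le p : ball x (d / 4) p -> `|w p| <= 8 * M / d * `|v|.
  move=> /in_half[xp xpv].
  by have := weak_harmonic_lipschitz d_gt0 hu u_le xpv xp; rewrite addrAC subrr add0r.
have -> : 256 * M / d ^+ 2 * `|v| * `|y - z| =
    8 * (8 * M / d * `|v|) / (d / 4) * `|y - z| by field; rewrite gt_eqF.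
have half_quarter : d / 4 / 2 = d / 8 by field.
by apply: (weak_harmonic_lipschitz d4_gt0 hw w_le); rewrite half_quarter.
Qed.

End InteriorEstimates.

Section InverseSquareDistance.
Context {R : realType}.
Local Notation P := (R * R)%type.
Implicit Types (p x z : P) (a b r : R).

Definition sqr_dist p z : R := (z.1 - p.1) ^+ 2 + (z.2 - p.2) ^+ 2.

Lemma sqr_dist_ge p z r : 0 <= r <= `|p - z| -> r ^+ 2 <= sqr_dist p z.
Proof.
move=> /andP[r_ge0]; rewrite prod_normE le_max /= => /orP[] r_le.
  apply: (@le_trans _ _ (`|p.1 - z.1| ^+ 2)); first by rewrite ler_sqr.
  by rewrite real_normK ?num_real // -[leLHS]sqrrN opprB lerDl sqr_ge0.
apply: (@le_trans _ _ (`|p.2 - z.2| ^+ 2)); first by rewrite ler_sqr.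
by rewrite real_normK ?num_real // -[leLHS]sqrrN opprB lerDr sqr_ge0.
Qed.

Lemma sqr_dist_gt0 p z r : 0 < r <= `|p - z| -> 0 < sqr_dist p z.
Proof.
move=> /andP[r_gt0 r_le]; apply: (@lt_le_trans _ _ (r ^+ 2)).
  by rewrite exprn_gt0.
by rewrite sqr_dist_ge // r_le ltW.
Qed.

Lemma inv_sqr_dist_le p z r : 0 < r <= `|p - z| -> (sqr_dist p z)^-1 <= (r ^+ 2)^-1.
Proof.
move=> r_in; have /andP[r_gt0 r_le] := r_in.
by rewrite lef_pV2 ?posrE ?exprn_gt0 ?(sqr_dist_gt0 r_in) // sqr_dist_ge // r_le ltW.
Qed.

Lemma sqr_dist_le p z r : `|p - z| <= r -> sqr_dist p z <= 2 * r ^+ 2.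
Proof.
move=> pz_le; have r_ge0 := le_trans (normr_ge0 _) pz_le.
move: pz_le; rewrite prod_norm_le /= => /andP[le1 le2].
have sqr_le a : `|a| <= r -> a ^+ 2 <= r ^+ 2.
  by move=> a_le; rewrite -[leLHS]real_normK ?num_real // ler_sqr.
by rewrite mulr2n mulrDl !mul1r lerD // sqr_le // distrC.
Qed.

Lemma continuous_sqr_dist p : continuous (sqr_dist p).
Proof.
move=> z; have cvg1 : (fun y : P => y.1 - p.1) @ z --> z.1 - p.1.
  exact: cvgB cvg_fst (cvg_cst p.1).
have cvg2 : (fun y : P => y.2 - p.2) @ z --> z.2 - p.2.
  exact: cvgB cvg_snd (cvg_cst p.2).
exact: cvgD (cvgM cvg1 cvg1) (cvgM cvg2 cvg2).
Qed.

Lemma cvg_second_difference_inv_sqr a b : let A := a ^+ 2 + b ^+ 2 in 0 < A ->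
  s ^- 2 * (((a + s) ^+ 2 + b ^+ 2)^-1 + ((a - s) ^+ 2 + b ^+ 2)^-1 - 2 / A)
    @[s --> 0^'+] --> 2 * (4 * a ^+ 2 - A) / A ^+ 3.
Proof.
move=> A A_gt0; have A_neq0 : A != 0 by rewrite gt_eqF.
have cvg_s : s @[s --> (0 : R)^'+] --> (0 : R).
  by apply: cvg_at_right_filter; exact: cvg_id.
have cvg_plus : (a + s) ^+ 2 + b ^+ 2 @[s --> (0 : R)^'+] --> A.
  have cvg_as : a + s @[s --> (0 : R)^'+] --> a + 0 by exact: cvgD (cvg_cst a) cvg_s.
  by rewrite addr0 in cvg_as; exact: cvgD (cvgM cvg_as cvg_as) (cvg_cst (b ^+ 2)).
have cvg_minus : (a - s) ^+ 2 + b ^+ 2 @[s --> (0 : R)^'+] --> A.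
  have cvg_as : a - s @[s --> (0 : R)^'+] --> a - 0 by exact: cvgB (cvg_cst a) cvg_s.
  by rewrite subr0 in cvg_as; exact: cvgD (cvgM cvg_as cvg_as) (cvg_cst (b ^+ 2)).
pose num (s : R) := 2 * (4 * a ^+ 2 - A - s ^+ 2).
have cvg_num : num s @[s --> (0 : R)^'+] --> 2 * (4 * a ^+ 2 - A).
  have -> : 2 * (4 * a ^+ 2 - A) = 2 * (4 * a ^+ 2 - A - 0 * 0).
    by rewrite mulr0 subr0.
  exact: cvgM (cvg_cst (2 : R))
    (cvgB (cvg_cst (4 * a ^+ 2 - A)) (cvgM cvg_s cvg_s)).
rewrite -[A ^+ 3]/(A * (A * A)).
have A3_neq0 : A * (A * A) != 0 by rewrite !mulf_neq0.
apply: cvg_trans (cvgM cvg_num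
  (cvgV A3_neq0 (cvgM (cvg_cst A) (cvgM cvg_plus cvg_minus)))).
apply: near_eq_cvg; near=> s; rewrite /num /=.
have p_neq0 : (a + s) ^+ 2 + b ^+ 2 != 0.
  by rewrite gt_eqF //; near: s; exact: cvgr_gt cvg_plus _ A_gt0.
have m_neq0 : (a - s) ^+ 2 + b ^+ 2 != 0.
  by rewrite gt_eqF //; near: s; exact: cvgr_gt cvg_minus _ A_gt0.
have s_neq0 : s != 0 by near: s; exact: nbhs_right_neq.
by rewrite /A in A_neq0 *; field; rewrite A_neq0 p_neq0 m_neq0 s_neq0.
Unshelve. all: by end_near. Qed.

Lemma has_laplacian_inv_sqr_dist p x : 0 < sqr_dist p x ->
  has_laplacian (fun z => (sqr_dist p z)^-1) x (4 / sqr_dist p x ^+ 2).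
Proof.
rewrite /sqr_dist; set a := x.1 - p.1; set b := x.2 - p.2 => A_gt0.
have A_gt0C : 0 < b ^+ 2 + a ^+ 2 by rewrite addrC.
have -> : 4 / (a ^+ 2 + b ^+ 2) ^+ 2 =
    2 * (4 * a ^+ 2 - (a ^+ 2 + b ^+ 2)) / (a ^+ 2 + b ^+ 2) ^+ 3 +
    2 * (4 * b ^+ 2 - (b ^+ 2 + a ^+ 2)) / (b ^+ 2 + a ^+ 2) ^+ 3.
  by rewrite [b ^+ 2 + _]addrC; field; rewrite gt_eqF.
apply: cvg_trans (cvgD (cvg_second_difference_inv_sqr A_gt0)
  (cvg_second_difference_inv_sqr A_gt0C)).
apply: near_eq_cvg; apply: nearW => s.
rewrite fctE /five_point /= ![_ + s - _]addrAC ![_ - s - _]addrAC -/a -/b.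
by rewrite ![a ^+ 2 + _]addrC -mulrDr; congr (_ * _); ring.
Qed.

End InverseSquareDistance.

Section Harnack.
Context {R : realType}.
Local Notation P := (R * R)%type.
Implicit Types (u : P -> R) (p x y z : P) (D : set P) (r L rho m : R).

(* Comparison on the annulus [rho <= |p - z| <= L] with the subharmonic function
   [m rho^2 (1 / sqr_dist p z - 1 / L^2)]. *)
Lemma annulus_lower_bound u p L rho m z : 0 < rho -> 0 <= m ->
  weak_harmonic (cball p L) u ->
  (forall y, cball p L y -> 0 <= u y) ->
  (forall y, cball p rho y -> m <= u y) ->
  rho <= `|p - z| <= L ->
  m * rho ^+ 2 * ((sqr_dist p z)^-1 - (L ^+ 2)^-1) <= u z.
Proof.
move=> rho_gt0 m_ge0 hu u_ge0 m_le z_in.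
have rho2_gt0 : 0 < rho ^+ 2 by rewrite exprn_gt0.
have c_ge0 : 0 <= m * rho ^+ 2 by rewrite mulr_ge0 // ltW.
have L_gt0 : 0 < L by case/andP: z_in => *; lra.
pose b : P -> R := m * rho ^+ 2 *: ((fun y => (sqr_dist p y)^-1) - cst (L ^+ 2)^-1).
pose K := [set y | rho <= `|p - y| <= L].
suff : (b - u) z <= 0 by rewrite subr_le0.
apply: (@max_principle _ K); [exact: compact_annulus| | |exact: z_in].
  apply: continuous_in_subspaceT => y /set_mem/andP[y_ge y_le].
  apply: cvgB; last by case: (hu _ y_le).
  apply: cvgM; first exact: cvg_cst.
  apply: cvgB; last exact: cvg_cst.
  apply: cvgV; last exact: continuous_sqr_dist.
  by rewrite gt_eqF // (sqr_dist_gt0 (r := rho)) // rho_gt0.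
move=> y /andP[y_ge y_le].
have [y_le_rho|rho_lt] := leP `|p - y| rho.
  left; rewrite subr_le0 (le_trans _ (m_le _ _)) //.
  rewrite -[leRHS](mulfK (lt0r_neq0 rho2_gt0)) ler_wpM2l //.
  rewrite lerBlDr (le_trans (inv_sqr_dist_le (r := rho) _)) ?rho_gt0 // lerDl.
  by rewrite invr_ge0 sqr_ge0.
have [L_le|lt_L] := leP L `|p - y|.
  left; rewrite subr_le0 (le_trans _ (u_ge0 _ _)) //.
  by rewrite mulr_ge0_le0 // subr_le0 inv_sqr_dist_le ?L_gt0.
right; split.
  near=> y'; apply/andP; split; apply/ltW; near: y'.
    by apply: (cvgr_gt _ (@continuous_dist _ _ p y)).
  by apply: (cvgr_lt _ (@continuous_dist _ _ p y)).
exists (m * rho ^+ 2 * (4 / sqr_dist p y ^+ 2 - 0) - 0).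
  by rewrite !subr0 mulr_ge0 // divr_ge0 // sqr_ge0.
apply: has_laplacianB; last by case: (hu _ y_le).
apply: has_laplacianZ; apply: has_laplacianB; last exact: has_laplacian_cst.
apply: has_laplacian_inv_sqr_dist.
by rewrite (sqr_dist_gt0 (r := rho)) // rho_gt0.
Unshelve. all: by end_near. Qed.

Lemma distance_weighted_max u x r : 0 < r ->
  {within cball x r, continuous u} ->
  exists2 p, cball x r p & forall z, cball x r z ->
    u z * (r - `|x - z|) ^+ 2 <= u p * (r - `|x - p|) ^+ 2.
Proof.
move=> r_gt0 cu; pose d z := (r - `|x - z|) ^+ 2.
have cd : {within cball x r, continuous d}.
  apply: continuous_subspaceT => z.
  have cB : r - `|x - y| @[y --> z] --> r - `|x - z|.
    exact: cvgB (cvg_cst r) (@continuous_dist _ _ x z).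
  exact: (cvgM cB cB).
have cw : {within cball x r, continuous (fun z => u z * d z)}.
  by move=> z; exact: cvgM (cu z) (cd z).
have [p /set_mem xp p_max] := compact_EVT_max
  (ex_intro _ x (cball_center x (ltW r_gt0))) (@compact_cball _ x r) cw.
by exists p => // z xz; exact/p_max/mem_set.
Qed.

Lemma le4_near_distance_weighted_max u x p r z :
  (forall y, cball x r y -> 0 <= u y) ->
  (forall y, cball x r y ->
    u y * (r - `|x - y|) ^+ 2 <= u p * (r - `|x - p|) ^+ 2) ->
  ball p ((r - `|x - p|) / 2) z -> cball x r z /\ u z <= 4 * u p.
Proof.
set d := r - `|x - p| => u_ge0 p_max; rewrite -ball_normE /ball_ /= => pz.
have d_gt0 : 0 < d by have := normr_ge0 (p - z); lra.
have z_dist : d / 2 <= r - `|x - z| by have := ler_distD p x z; rewrite /d in pz *; lra.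
have xz : cball x r z by rewrite /closed_ball_ /=; lra.
split => //; have d2_gt0 : 0 < (d / 2) ^+ 2 by rewrite exprn_gt0 // divr_gt0.
rewrite -(ler_pM2r d2_gt0) [leRHS](_ : _ = u p * d ^+ 2); last by field.
apply: le_trans (p_max _ xz); apply: ler_wpM2l; first exact: u_ge0.
by rewrite ler_sqr ?nnegrE //; lra.
Qed.

Lemma weak_harmonic_half_le u p r z : 0 < r -> 0 <= u p ->
  weak_harmonic (ball p r) u -> (forall y, ball p r y -> `|u y| <= 4 * u p) ->
  cball p (r / 64) z -> u p / 2 <= u z.
Proof.
move=> r_gt0 up_ge0 hu u_le; rewrite /closed_ball_ /= => pz.
have pin : ball p (r / 2) p by apply: ballxx; lra.
have zin : ball p (r / 2) z by rewrite -ball_normE /ball_ /=; lra.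
have := weak_harmonic_lipschitz r_gt0 hu u_le pin zin; rewrite ler_distl.
have c_ge0 : 0 <= 8 * (4 * u p) / r by rewrite divr_ge0 ?mulr_ge0 // ltW.
have := ler_wpM2l c_ge0 pz.
rewrite [leRHS](_ : _ = u p / 2); last by field; rewrite gt_eqF.
by lra.
Qed.

Lemma weak_harmonic_center_ge u x p r rho m : 0 <= m -> 0 < rho <= r ->
  weak_harmonic (ball x (4 * r)) u -> (forall z, ball x (4 * r) z -> 0 <= u z) ->
  cball x r p ->
  (forall z, cball p rho z -> m <= u z) ->
  m * rho ^+ 2 <= 4 * r ^+ 2 * u x.
Proof.
move=> m_ge0 /andP[rho_gt0 rho_le] hu u_ge0 xp m_le; rewrite /closed_ball_ /= in xp.
have r_gt0 : 0 < r by lra.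
have [r2_gt0 rho2_ge0] : 0 < r ^+ 2 /\ 0 <= rho ^+ 2 by rewrite exprn_gt0 // sqr_ge0.
have ux_ge0 : 0 <= u x by apply/u_ge0/ballxx; lra.
have [px_le|px_gt] := leP `|p - x| rho.
  have := m_le x px_le => mx.
  apply: (@le_trans _ _ (u x * r ^+ 2)).
    by apply: ler_pM; rewrite ?ler_sqr ?nnegrE //; lra.
  by have := mulr_ge0 ux_ge0 (ltW r2_gt0); lra.
have p_sub : cball p (2 * r) `<=` ball x (4 * r).
  by apply: cball_sub_ball; lra.
have px_in : rho <= `|p - x| <= 2 * r by rewrite (ltW px_gt) distrC; lra.
have := annulus_lower_bound rho_gt0 m_ge0 (sub_weak_harmonic p_sub hu)
  (fun z pz => u_ge0 _ (p_sub _ pz)) m_le px_in.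
have dist_inv : (4 * r ^+ 2)^-1 <= (sqr_dist p x)^-1 - ((2 * r) ^+ 2)^-1.
  have -> : (4 * r ^+ 2)^-1 = (2 * r ^+ 2)^-1 - ((2 * r) ^+ 2)^-1.
    by field; rewrite gt_eqF.
  have dist_gt0 : 0 < sqr_dist p x.
    by apply: (@sqr_dist_gt0 _ _ _ rho); rewrite rho_gt0 ltW.
  by rewrite lerD2r lef_pV2 ?posrE ?mulr_gt0 // sqr_dist_le // distrC.
move=> /(le_trans (ler_wpM2l (mulr_ge0 m_ge0 rho2_ge0) dist_inv)).
by rewrite ler_pdivrMr ?mulr_gt0 // [u x * _]mulrC.
Qed.

(* Around [p] the gradient bound keeps [u] above [u p / 2] on a ball of radius
   proportional to [r - |x - p|], and the annulus barrier carries this to [x]. *)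
Lemma distance_weighted_max_le u x p r : 0 < r ->
  weak_harmonic (ball x (4 * r)) u -> (forall z, ball x (4 * r) z -> 0 <= u z) ->
  cball x r p ->
  (forall z, cball x r z ->
    u z * (r - `|x - z|) ^+ 2 <= u p * (r - `|x - p|) ^+ 2) ->
  u p * (r - `|x - p|) ^+ 2 <= 8 * 128 ^+ 2 * r ^+ 2 * u x.
Proof.
move=> r_gt0 hu u_ge0 xp p_max.
have r_sub : cball x r `<=` ball x (4 * r).
  by apply: cball_sub_ball; rewrite subrr normr0; lra.
have u_ge0_r y (xy : cball x r y) := u_ge0 y (r_sub y xy).
have near_p y := le4_near_distance_weighted_max u_ge0_r p_max (z := y).
have := normr_ge0 (x - p); rewrite /closed_ball_ /= in xp.
set d := r - `|x - p| in near_p *; move=> d_le.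
have [d_le0|d_gt0] := leP d 0.
  have -> : d = 0 by rewrite /d in d_le0 *; lra.
  have ux_ge0 : 0 <= u x by apply/u_ge0/ballxx; lra.
  by rewrite expr0n mulr0; have := mulr_ge0 (sqr_ge0 r) ux_ge0; lra.
have half_le y : cball p (d / 128) y -> u p / 2 <= u y.
  rewrite (_ : d / 128 = d / 2 / 64); last by field.
  apply: weak_harmonic_half_le; [lra|exact: u_ge0_r| |].
    by apply: sub_weak_harmonic hu => q /near_p[/r_sub].
  by move=> q /near_p[/u_ge0_r uq_ge0 uq_le]; rewrite ger0_norm.
have up_ge0 : 0 <= u p / 2 by rewrite divr_ge0 // u_ge0_r.
have rho_in : 0 < d / 128 <= r by rewrite /d in d_gt0 *; lra.
have := weak_harmonic_center_ge up_ge0 rho_in hu u_ge0 xp half_le.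
have -> : u p / 2 * (d / 128) ^+ 2 = u p * d ^+ 2 / (2 * 128 ^+ 2) by field.
rewrite ler_pdivrMr ?mulr_gt0 ?exprn_gt0 //.
by congr (_ <= _); ring.
Qed.

Definition harnack_const : R := 32 * 128 ^+ 2.

Lemma harnack_const_ge0 : 0 <= harnack_const.
Proof. by rewrite mulr_ge0 ?exprn_ge0 ?ler0n. Qed.

Lemma harnack_half_ball u x r z : 0 < r -> weak_harmonic (ball x (4 * r)) u ->
  (forall y, ball x (4 * r) y -> 0 <= u y) ->
  ball x (r / 2) z -> u z <= harnack_const * u x.
Proof.
move=> r_gt0 hu u_ge0; rewrite -ball_normE /ball_ /= => xz.
have r_sub : cball x r `<=` ball x (4 * r).
  by apply: cball_sub_ball; rewrite subrr normr0; lra.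
have cu : {within cball x r, continuous u}.
  by apply: continuous_in_subspaceT => y /set_mem/r_sub/hu[].
have [p xp p_max] := distance_weighted_max r_gt0 cu.
have zr : cball x r z by rewrite /closed_ball_ /=; lra.
have r2_gt0 : 0 < (r / 2) ^+ 2 by rewrite exprn_gt0 // divr_gt0.
rewrite -(ler_pM2r r2_gt0); apply: (@le_trans _ _ (u z * (r - `|x - z|) ^+ 2)).
  by rewrite ler_wpM2l ?u_ge0 ?ler_sqr ?nnegrE //; [exact: r_sub|lra|lra|lra].
apply: (le_trans (p_max _ zr)).
have -> : harnack_const * u x * (r / 2) ^+ 2 = 8 * 128 ^+ 2 * r ^+ 2 * u x.
  by rewrite /harnack_const; field.
exact: distance_weighted_max_le r_gt0 hu u_ge0 xp p_max.
Qed.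

Definition harnack_bound D x (C : R) : set P := [set z | forall u,
  weak_harmonic D u -> (forall y, D y -> 0 <= u y) -> u z <= C * u x].

Lemma harnack_near D y : open D -> D y -> exists2 r, 0 < r &
  forall x z, ball y r x -> ball y r z -> harnack_bound D x harnack_const z.
Proof.
move=> oD Dy; have /nbhs_ballP[e /= e_gt0 yeD] := open_nbhs_nbhs (conj oD Dy).
exists (e / 32); first by rewrite divr_gt0.
move=> x z; rewrite -!ball_normE /ball_ /= => yx yz u hu u_ge0.
have xD : ball x (4 * (e / 8)) `<=` D.
  by apply: subset_trans yeD; apply: ball_sub_ball; lra.
apply: (@harnack_half_ball _ _ (e / 8)).
- by rewrite divr_gt0.
- exact: sub_weak_harmonic hu.
- by move=> a /xD/u_ge0.
rewrite -ball_normE /ball_ /=; have := ler_distD y x z.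
by rewrite [`|x - y|]distrC; lra.
Qed.

Lemma harnack D x y : open D -> connected D -> D x -> D y ->
  exists2 C, 0 <= C & nbhs y (harnack_bound D x C).
Proof.
move=> oD cD Dx.
pose B := D `&` [set y | exists2 C, 0 <= C & nbhs y (harnack_bound D x C)].
suff BD : B = D by rewrite -[D y]/(D y) -{1}BD => -[].
apply: cD.
- exists x; split => //; have [r r_gt0 hr] := harnack_near oD Dx.
  exists harnack_const; first exact: harnack_const_ge0.
  by apply: filterS (nbhsx_ballx x r r_gt0) => z; exact: hr (ballxx x r_gt0).
- exists B; last by rewrite /B setIA setIid.
  apply: openI => //; rewrite openE => z [C C_ge0 /nbhs_interior bound_z].
  by apply: filterS bound_z => t ?; exists C.
exists (closure B); first exact: closed_closure.
apply/seteqP; split=> [z Bz|z [Dz clBz]].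
  by split; [case: Bz|exact: subset_closure].
split => //; have [r r_gt0 hr] := harnack_near oD Dz.
have [t [[Dt [C C_ge0 bound_t]] zt]] := clBz _ (nbhsx_ballx z r r_gt0).
exists (harnack_const * C); first by rewrite mulr_ge0 // harnack_const_ge0.
apply: filterS (nbhsx_ballx z r r_gt0) => a za u hu u_ge0.
apply: le_trans (hr _ _ zt za _ hu u_ge0) _.
by rewrite -mulrA ler_wpM2l ?harnack_const_ge0 //; exact: (nbhs_singleton bound_t).
Qed.

Lemma harnack_ball D x y : open D -> connected D -> D x -> D y ->
  exists C r, [/\ 0 <= C, 0 < r, ball y r `<=` D & ball y r `<=` harnack_bound D x C].
Proof.
move=> oD cD Dx Dy; have [C C_ge0 Cx] := harnack oD cD Dx Dy.
have /nbhs_ballP[r /= r_gt0 rDC] : nbhs y (D `&` harnack_bound D x C).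
  by apply: filterI => //; exact: open_nbhs_nbhs.
by exists C, r; split=> // z /rDC[].
Qed.

End Harnack.

Section DirectionalDerivatives.
Context {R : realType} {V : normedModType R}.
Implicit Types (f g : V -> R) (x v : V) (a b K : R).

Let line_quotient f x v (t : R) :
  (fun h : R => h^-1 *: ((f \o shift (x + t *: v)) (h *: v) - f (x + t *: v))) =
  (fun h : R => h^-1 *: (((fun s : R => f (x + s *: v)) \o shift t) (h *: (1 : R))
    - f (x + t *: v))).
Proof.
apply/funext => h /=; congr (_ *: (f _ - _)).
by rewrite [h *: 1]mulr1 scalerDl addrCA.
Qed.

Lemma derivable_line f x v (t : R) :
  derivable f (x + t *: v) v = derivable (fun s : R => f (x + s *: v)) t (1 : R).
Proof. by rewrite /derivable line_quotient. Qed.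

Lemma derive_line f x v (t : R) :
  'D_v f (x + t *: v) = 'D_(1 : R) (fun s : R => f (x + s *: v)) t.
Proof. by rewrite /derive line_quotient. Qed.

Lemma is_derive_line f x v (t : R) : derivable f (x + t *: v) v ->
  is_derive t (1 : R) (fun s : R => f (x + s *: v)) ('D_v f (x + t *: v)).
Proof. by rewrite derivable_line derive_line => /derivableP. Qed.

Lemma ler_line_increment f x v a b K : a <= b ->
  (forall t, a <= t <= b -> derivable f (x + t *: v) v) ->
  (forall t, a <= t <= b -> `|'D_v f (x + t *: v)| <= K) ->
  `|f (x + b *: v) - f (x + a *: v)| <= K * (b - a).
Proof.
move=> a_le_b df df_le.
have der t (t_in : a <= t <= b) := is_derive_line (df t t_in).
have [||c] := @MVT_segment R (fun s => f (x + s *: v)) (fun s => 'D_v f (x + s *: v))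
  a b a_le_b.
- by move=> t; rewrite in_itv /= => t_in; apply: der; lra.
- apply: derivable_within_continuous => t; rewrite in_itv /= => /der d.
  exact: ex_derive.
rewrite in_itv /= => /df_le c_le ->; rewrite normrM [`|b - a|]ger0_norm ?subr_ge0 //.
by rewrite ler_wpM2r ?subr_ge0.
Qed.

Definition difference_quotient f x v (h : R) : R := h^-1 *: (f (h *: v + x) - f x).

Lemma difference_quotientB f g x v (h : R) : difference_quotient (f - g) x v h =
  difference_quotient f x v h - difference_quotient g x v h.
Proof. by rewrite /difference_quotient -scalerBr !fctE; congr (_ *: _); ring. Qed.

Lemma difference_quotient_le f x v (r h K : R) : h != 0 -> `|h *: v| < r ->
  (forall z, ball x r z -> derivable f z v) ->
  (forall z, ball x r z -> `|'D_v f z| <= K) ->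
  `|difference_quotient f x v h| <= K.
Proof.
move=> h_neq0 hv_lt f_der df_le.
rewrite normrZ normfV ler_pdivrMl ?normr_gt0 // mulrC [h *: v + x]addrC.
have in_ball t : `|t| <= `|h| -> ball x r (x + t *: v).
  move=> t_le; rewrite -ball_normE /ball_ /= opprD addNKr normrN.
  by apply: le_lt_trans hv_lt; rewrite !normrZ ler_wpM2r.
have x0 : f x = f (x + 0 *: v) by rewrite scale0r addr0.
have [h_ge0|/ltW h_le0] := leP 0 h.
  rewrite [`|h|]ger0_norm // x0 -[X in K * X]subr0.
  apply: ler_line_increment => [//|t t_in|t t_in].
    by apply/f_der/in_ball; rewrite !ger0_norm //; lra.
  by apply/df_le/in_ball; rewrite !ger0_norm //; lra.
rewrite [`|h|]ler0_norm // x0 distrC -[X in K * X]sub0r.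
apply: ler_line_increment => [//|t t_in|t t_in].
  by apply/f_der/in_ball; rewrite !ler0_norm //; lra.
by apply/df_le/in_ball; rewrite !ler0_norm //; lra.
Qed.

Lemma derive_le_lipschitz f x v K : derivable f x v ->
  (\forall y \near x, `|f y - f x| <= K * `|y - x|) -> `|'D_v f x| <= K * `|v|.
Proof.
move=> df f_lip; apply: (cvgr_to_le (cvg_norm df)).
have lip_line : \forall h \near (0 : R)^',
    `|f (x + h *: v) - f x| <= K * `|x + h *: v - x|.
  by apply: cvg_within; exact: (cvg_line v f_lip).
near=> h; rewrite normrZ normfV ler_pdivrMl ?normr_gt0; last first.
  by near: h; exact: nbhs_dnbhs_neq.
have : `|f (x + h *: v) - f x| <= K * `|x + h *: v - x| by near: h.
by rewrite [x + _]addrC addrK normrZ mulrCA.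
Unshelve. all: by end_near. Qed.

End DirectionalDerivatives.

Section SecondDifferences.
Context {R : realType}.
Implicit Types (f df : R -> R) (a l : R).

Lemma cvg_symmetric_difference f a l : is_derive a (1 : R) f l ->
  (f (a + s) - f (a - s)) / (2 * s) @[s --> 0^'+] --> l.
Proof.
move=> [f_der f_val]; pose q (h : R) : R := h^-1 *: (f (h *: (1 : R) + a) - f a).
have cq : q h @[h --> 0^'] --> l by rewrite -f_val; exact: f_der.
have cr : q s @[s --> 0^'+] --> l by exact: cvg_dnbhs_at_right.
have cl : q (- s) @[s --> 0^'+] --> l.
  by rewrite -[X in X^'+]oppr0; apply/(cvg_at_leftNP q); exact: cvg_dnbhs_at_left.
rewrite [l](_ : _ = (l + l) / 2); last by field.
apply: cvg_trans (cvgM (cvgD cr cl) (cvg_cst (2^-1 : R))); apply: near_eq_cvg; near=> s.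
have s_neq0 : s != 0 by near: s; exact: nbhs_right_neq.
rewrite !fctE /q /GRing.scale /= !mulr1 [s + a]addrC [- s + a]addrC.
by field; rewrite s_neq0.
Unshelve. all: by end_near. Qed.

Lemma cvg_second_difference f df a l :
  (\forall t \near a, is_derive t (1 : R) f (df t)) -> is_derive a (1 : R) df l ->
  s ^- 2 * (f (a + s) + f (a - s) - 2 * f a) @[s --> 0^'+] --> l.
Proof.
move=> /nbhs_ballP[r /= r_gt0 f_der] df_der.
have f_der_at t : `|t| < r -> is_derive (a + t) (1 : R) f (df (a + t)).
  by move=> t_lt; apply: f_der; rewrite -ball_normE /ball_ /= opprD addNKr normrN.
pose F (s : R) := f (a + s) + f (a - s) - 2 * f a.
have F_der s : `|s| < r -> is_derive s (1 : R) F (df (a + s) - df (a - s)).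
  move=> s_lt; have f_der_r := f_der_at _ s_lt.
  have f_der_l : is_derive (a - s) (1 : R) f (df (a - s)).
    by apply: f_der_at; rewrite normrN.
  have der_r : is_derive s (1 : R) (fun t => f (a + t)) (df (a + s) * (0 + 1)).
    exact: is_derive1_comp.
  have der_l : is_derive s (1 : R) (fun t => f (a - t)) (df (a - s) * (0 - 1)).
    exact: is_derive1_comp.
  have := is_deriveB (is_deriveD der_r der_l) (is_derive_cst (2 * f a) s 1).
  by rewrite add0r sub0r mulr1 mulrN1 subr0.
have F0 : F s @[s --> 0^'+] --> 0.
  have F_0 : F 0 = 0 by rewrite /F subr0 addr0; ring.
  have F_der0 : derivable F 0 1.
    by apply: (@ex_derive _ _ _ _ _ _ _ (F_der 0 _)); rewrite normr0.
  rewrite -[X in _ --> X]F_0; apply: cvg_at_right_filter.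
  by apply: differentiable_continuous; apply/derivable1_diffP.
have sqr0 : s * s @[s --> (0 : R)^'+] --> (0 : R).
  rewrite -[X in _ --> X](mulr0 0); apply: cvg_at_right_filter.
  exact: (cvgM cvg_id cvg_id).
have sqr_der (s : R) : is_derive s (1 : R) (fun t => t * t) (2 * s).
  have -> : 2 * s = s *: (1 : R) + s *: (1 : R) by rewrite /GRing.scale /=; ring.
  exact: is_deriveM.
have near0 s : s \in `]0, r[ -> 0 < s /\ `|s| < r.
  by rewrite in_itv /= => /andP[s_gt0 s_lt]; rewrite gtr0_norm.
have := lhopital_at_right r_gt0 (fun s sr => F_der s (near0 s sr).2)
  (fun s _ => sqr_der s) F0 sqr0.
move=> /(_ l)/(_ _ (cvg_symmetric_difference df_der)) lim_F.
have F_lim : F s / (s * s) @[s --> 0^'+] --> l.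
  by apply: lim_F => s /near0[s_gt0 _]; rewrite mulf_neq0 // gt_eqF.
by apply: cvg_trans F_lim; apply: near_eq_cvg; apply: nearW => s; rewrite mulrC.
Qed.

Lemma cvg_second_difference_along (V : normedModType R) (f : V -> R) (x v : V) :
  (\forall y \near x, derivable f y v) -> derivable ('D_v f) x v ->
  s ^- 2 * (f (x + s *: v) + f (x - s *: v) - 2 * f x) @[s --> 0^'+] -->
    'D_v ('D_v f) x.
Proof.
have line0 : x + (0 : R) *: v = x by rewrite scale0r addr0.
move=> f_der df_der; pose g (s : R) := f (x + s *: v).
pose dg (s : R) := 'D_v f (x + s *: v).
have g_der : \forall t \near 0, is_derive t (1 : R) g (dg t).
  have line_der : \forall t \near (0 : R), derivable f (x + t *: v) v.
    exact: (cvg_line v f_der).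
  by apply: filterS line_der => t; exact: is_derive_line.
have dg_der : is_derive (0 : R) (1 : R) dg ('D_v ('D_v f) x).
  by rewrite -[X in 'D_v ('D_v f) X]line0; apply: is_derive_line; rewrite line0.
apply: cvg_trans (cvg_second_difference g_der dg_der); apply: near_eq_cvg.
by apply: nearW => s; rewrite /g add0r sub0r scaleNr line0.
Qed.

End SecondDifferences.

Section Partials.
Context {R : realType}.
Local Notation P := (R * R)%type.
Implicit Types (u : P -> R) (x : P) (D : set P) (b : bool).

Definition axis b : P := if b then (1, 0) else (0, 1).

Lemma scale_axis1 (t : R) : t *: axis true = (t, 0).
Proof. by congr pair; [exact: mulr1|exact: mulr0]. Qed.

Lemma scale_axis2 (t : R) : t *: axis false = (0, t).
Proof. by congr pair; [exact: mulr0|exact: mulr1]. Qed.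

Let line1E x (t : R) : (0, x.2) + t *: axis true = (t, x.2).
Proof. by rewrite scale_axis1; congr pair; [exact: add0r|exact: addr0]. Qed.

Let line2E x (t : R) : (x.1, 0) + t *: axis false = (x.1, t).
Proof. by rewrite scale_axis2; congr pair; [exact: addr0|exact: add0r]. Qed.

Lemma partial1E u : partial1 u = 'D_(axis true) u.
Proof.
apply/funext => x; rewrite {2}[x]surjective_pairing -line1E derive_line.
rewrite /partial1 derive1E.
by under [in RHS]eq_fun do rewrite line1E.
Qed.

Lemma partial2E u : partial2 u = 'D_(axis false) u.
Proof.
apply/funext => x; rewrite {2}[x]surjective_pairing -line2E derive_line.
rewrite /partial2 derive1E.
by under [in RHS]eq_fun do rewrite line2E.
Qed.

Lemma has_partial1E u x : has_partial1 u x = derivable u x (axis true).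
Proof.
rewrite {2}[x]surjective_pairing -line1E derivable_line.
by under [in RHS]eq_fun do rewrite line1E.
Qed.

Lemma has_partial2E u x : has_partial2 u x = derivable u x (axis false).
Proof.
rewrite {2}[x]surjective_pairing -line2E derivable_line.
by under [in RHS]eq_fun do rewrite line2E.
Qed.

Lemma C1_onP D u : C1_on D u <->
  [/\ {in D, continuous u}, forall b x, D x -> derivable u x (axis b) &
     forall b, {in D, continuous ('D_(axis b) u)}].
Proof.
rewrite /C1_on partial1E partial2E; split=> [[cu [du [cdu1 cdu2]]]|[cu du cdu]].
  split; [exact: cu| |by case; [exact: cdu1|exact: cdu2]].
  by move=> b x /du; rewrite has_partial1E has_partial2E => -[]; case: b.
split; [exact: cu|split; last by split; [exact: (cdu true)|exact: (cdu false)]].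
by move=> x Dx; rewrite has_partial1E has_partial2E; split; exact: du.
Qed.

Lemma C2_onP D u : C2_on D u <-> C1_on D u /\ forall b, C1_on D ('D_(axis b) u).
Proof.
rewrite /C2_on partial1E partial2E.
split=> [[C1u [C1du1 C1du2]]|[C1u C1du]].
  by split; [exact: C1u|case; [exact: C1du1|exact: C1du2]].
by split; [exact: C1u|split; [exact: (C1du true)|exact: (C1du false)]].
Qed.

Lemma laplacianE u x : laplacian u x =
  'D_(axis true) ('D_(axis true) u) x + 'D_(axis false) ('D_(axis false) u) x.
Proof. by rewrite /laplacian !partial1E !partial2E. Qed.

Lemma harmonic_on_weak_harmonic D u : open D -> harmonic_on D u -> weak_harmonic D u.
Proof.
move=> oD [/C2_onP[/C1_onP[cu du _] C2u] lapu] x Dx; split.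
  by apply: cu; rewrite inE.
have Dnear : \forall y \near x, D y by exact: open_nbhs_nbhs.
rewrite -(lapu x Dx) laplacianE.
have cvg_along b : s ^- 2 * (u (x + s *: axis b) + u (x - s *: axis b) - 2 * u x)
    @[s --> 0^'+] --> 'D_(axis b) ('D_(axis b) u) x.
  apply: cvg_second_difference_along.
    by apply: filterS Dnear => y; exact: du.
  by have /C1_onP[_ d2u _] := C2u b; exact: d2u.
apply: cvg_trans (cvgD (cvg_along true) (cvg_along false)).
apply: near_eq_cvg; apply: nearW => s.
rewrite !fctE /five_point -mulrDr scale_axis1 scale_axis2; congr (_ * _).
have -> : x + (s, 0) = (x.1 + s, x.2) by congr pair; exact: addr0.
have -> : x - (s, 0) = (x.1 - s, x.2) by congr pair; exact: subr0.
have -> : x + (0, s) = (x.1, x.2 + s) by congr pair; exact: addr0.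
have -> : x - (0, s) = (x.1, x.2 - s) by congr pair; exact: subr0.
by ring.
Qed.

End Partials.

Section LocallyUniformConvergence.
Context {R : realType} {V : normedModType R}.
Implicit Types (w g : V -> R) (ws gs es : nat -> V -> R) (x v : V) (A B D : set V).

Lemma uniform_cvgP A ws w : {uniform A, ws @ \oo --> w} <->
  forall e : R, 0 < e ->
    \forall n \near \oo, forall z, A z -> `|ws n z - w z| <= e.
Proof.
split=> [ws_w e e_gt0|ws_w B /uniform_nbhs[E [entE EB]]].
  have : nbhs (w : {uniform` A -> R}) [set h | forall z, A z -> `|h z - w z| <= e].
    apply/uniform_nbhs; exists [set yz | ball yz.1 e yz.2]; split.
      exact: (entourage_ball _ (PosNum e_gt0)).
    by move=> h wh z /wh; rewrite /= -ball_normE /= distrC => /ltW.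
  by move=> /ws_w.
move: entE; rewrite -entourage_ballE => -[e /= e_gt0 eE].
have e2_gt0 : 0 < e / 2 by rewrite divr_gt0.
near=> n; apply: EB => z Az; apply: eE; rewrite /= -ball_normE /= distrC.
apply: (@le_lt_trans _ _ (e / 2)); last by rewrite ltr_pdivrMr // ltr_pMr // ltr1n.
by move: z Az; near: n; exact: ws_w.
Unshelve. all: by end_near. Qed.

Definition uniform_cauchy A ws : Prop := forall e : R, 0 < e ->
  \forall n \near \oo, forall m z, (n <= m)%N -> A z -> `|ws m z - ws n z| <= e.

Lemma uniform_cauchy_le A B ws gs (C : R) : 0 <= C ->
  (forall m n M, (n <= m)%N -> (forall z, A z -> `|ws m z - ws n z| <= M) ->
    forall z, B z -> `|gs m z - gs n z| <= C * M) ->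
  uniform_cauchy A ws -> uniform_cauchy B gs.
Proof.
move=> C_ge0 gs_le ws_c e e_gt0; have C1_gt0 : 0 < C + 1 by lra.
apply: filterS (ws_c _ (divr_gt0 e_gt0 C1_gt0)) => n hn m z nm Bz.
apply: le_trans (gs_le _ _ _ nm (fun y Ay => hn m y nm Ay) z Bz) _.
by rewrite mulrA ler_pdivrMr // mulrC mulrDr mulr1 lerDl ltW.
Qed.

Definition locally_uniform_cvg D ws w : Prop := forall x, D x ->
  exists2 r : R, 0 < r & ball x r `<=` D /\ {uniform ball x r, ws @ \oo --> w}.

Definition locally_uniform_cauchy D ws : Prop := forall x, D x ->
  exists2 r : R, 0 < r & ball x r `<=` D /\ uniform_cauchy (ball x r) ws.

Lemma locally_uniform_cvg_squeeze D ws w es : locally_uniform_cvg D es (cst 0) ->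
  (forall n z, D z -> `|ws n z - w z| <= es n z) -> locally_uniform_cvg D ws w.
Proof.
move=> es0 ws_le x /es0[r r_gt0 [rD /uniform_cvgP es_small]].
exists r => //; split; first exact: rD.
apply/uniform_cvgP => e /es_small; apply: filterS => n hn z xz.
apply: le_trans (ws_le n z (rD z xz)) _.
by have := hn z xz; rewrite subr0 ler_norml; lra.
Qed.

Lemma uniform_cvg_cauchy A ws w : {uniform A, ws @ \oo --> w} -> uniform_cauchy A ws.
Proof.
move=> /uniform_cvgP ws_w e e_gt0; have [N _ hN] := ws_w _ (divr_gt0 e_gt0 (ltr0n _ 2)).
exists N => // n /= Nn m z nm Az.
have := hN _ Nn z Az; have := hN _ (leq_trans Nn nm) z Az.
have := ler_distD (w z) (ws m z) (ws n z); rewrite [`|w z - _|]distrC; lra.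
Qed.

Lemma locally_uniform_cvg_cauchy D ws w :
  locally_uniform_cvg D ws w -> locally_uniform_cauchy D ws.
Proof.
move=> ws_w x /ws_w[r r_gt0 [rD /uniform_cvg_cauchy ws_c]].
by exists r.
Qed.

Lemma uniform_cauchy_cvg A ws :
  uniform_cauchy A ws -> {uniform A, ws @ \oo --> (fun z => limn (ws ^~ z))}.
Proof.
move=> ws_c.
have ws_cvg z : A z -> cvgn (ws ^~ z).
  move=> Az; apply/cauchy_cvgP/cauchy_exP => e e_gt0.
  have [N _ hN] := ws_c _ (divr_gt0 e_gt0 (ltr0n _ 2)).
  exists (ws N z); exists N => // m /= Nm; rewrite -ball_normE /= distrC.
  by have := hN N (leqnn N) m z Nm Az; lra.
apply/uniform_cvgP => e /ws_c[N _ hN]; exists N => // n Nn z Az; rewrite distrC.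
apply: (cvgr_to_le (cvg_norm (cvgB (ws_cvg z Az) (cvg_cst (ws n z))))).
by exists n => // m nm; exact: hN.
Qed.

Lemma locally_uniform_cvg_ptws D ws w x :
  locally_uniform_cvg D ws w -> D x -> ws ^~ x @ \oo --> w x.
Proof.
move=> ws_w /ws_w[r r_gt0 [_ /uniform_cvgP xr]]; apply/cvgrPdist_le => e e_gt0.
apply: filterS (xr e e_gt0) => n hn; rewrite distrC; exact/hn/ballxx.
Qed.

Lemma locally_uniform_cvg_continuous D ws w :
  (forall n, {in D, continuous (ws n)}) -> locally_uniform_cvg D ws w ->
  {in D, continuous w}.
Proof.
move=> cws ws_w x /set_mem/ws_w[r r_gt0 [rD xr]].
have : {within ball x r, continuous w}.
  apply: uniform_limit_continuous_subspace xr; exists 0%N => // n _.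
  by apply: continuous_in_subspaceT => z /set_mem/rD/mem_set/cws.
by rewrite continuous_open_subspace; [apply; exact/mem_set/ballxx|exact: ball_open].
Qed.

(* By the mean value theorem the difference quotients of [ws m - ws n] are small
   uniformly in the increment, so the limits in [n] and in the increment commute. *)
Lemma is_derive_uniform_limit A ws w g x v : open A -> A x ->
  (forall n z, A z -> derivable (ws n) z v) ->
  (forall z, A z -> ws ^~ z @ \oo --> w z) ->
  {uniform A, (fun n => 'D_v (ws n)) @ \oo --> g} -> is_derive x v w (g x).
Proof.
move=> oA Ax ws_der ws_w dws_g.
have /nbhs_ballP[r /= r_gt0 rA] := open_nbhs_nbhs (conj oA Ax).
pose q f h := difference_quotient f x v h.
suff cq : q w h @[h --> 0^'] --> g x.
  by split; [apply/cvg_ex; exists (g x)|apply/cvg_lim].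
apply/cvgrPdist_le => e e_gt0.
have e4_gt0 : 0 < e / 4 by rewrite divr_gt0.
have [N _ hN] := (uniform_cvgP _ _ _).1 dws_g _ e4_gt0.
have cqN : q (ws N) h @[h --> 0^'] --> 'D_v (ws N) x by exact: ws_der.
near=> h.
have h_neq0 : h != 0 by near: h; exact: nbhs_dnbhs_neq.
have hv_lt : `|h *: v| < r by near: h; exact: near0_norm_scale_lt.
have qN_le : `|'D_v (ws N) x - q (ws N) h| <= e / 4.
  by near: h; exact: (cvgrPdist_le _ _).1 cqN _ e4_gt0.
have := hN N (leqnn N) x Ax.
suff : `|q w h - q (ws N) h| <= e / 2.
  by move: qN_le; rewrite !ler_distl; lra.
have x_hv : ball x r (h *: v + x).
  by rewrite -ball_normE /ball_ /= opprD addrCA subrr addr0 normrN.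
have cq_h : q (ws m) h @[m --> \oo] --> q w h.
  exact: cvgZ (cvg_cst h^-1) (cvgB (ws_w _ (rA _ x_hv)) (ws_w _ Ax)).
apply: (cvgr_to_le (cvg_norm (cvgB cq_h (cvg_cst (q (ws N) h))))).
exists N => // m /= Nm; have f_der z : ball x r z -> derivable (ws m - ws N) z v.
  by move=> /rA Az; apply: derivableB; exact: ws_der.
have df_le z : ball x r z -> `|'D_v (ws m - ws N) z| <= e / 2.
  move=> /rA Az; rewrite deriveB; try exact: ws_der.
  by have := hN m Nm z Az; have := hN N (leqnn N) z Az; rewrite !ler_distl; lra.
suff : `|q (ws m) h - q (ws N) h| <= e / 2 by [].
by rewrite /q -difference_quotientB; exact: difference_quotient_le df_le.
Unshelve. all: by end_near. Qed.

Lemma locally_uniform_derive D ws w v :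
  (forall n z, D z -> derivable (ws n) z v) -> locally_uniform_cvg D ws w ->
  locally_uniform_cauchy D (fun n => 'D_v (ws n)) ->
  (forall x, D x -> derivable w x v) /\
  locally_uniform_cvg D (fun n => 'D_v (ws n)) ('D_v w).
Proof.
move=> ws_der ws_w dws_cauchy; pose g z := limn (fun n => 'D_v (ws n) z).
have w_der x : D x -> exists2 r : R, 0 < r & [/\ ball x r `<=` D,
    {uniform ball x r, (fun n => 'D_v (ws n)) @ \oo --> g} &
    forall z, ball x r z -> is_derive z v w (g z)].
  move=> /dws_cauchy[r r_gt0 [rD /uniform_cauchy_cvg dws_g]].
  exists r => //; split=> // z xz.
  apply: (@is_derive_uniform_limit (ball x r)) dws_g => //; first exact: ball_open.
    by move=> n y /rD; exact: ws_der.
  by move=> y /rD; exact: locally_uniform_cvg_ptws.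
split=> x /w_der[r r_gt0 [rD dws_g w_dz]].
  by case: (w_dz x (ballxx x r_gt0)).
exists r => //; split; first exact: rD.
apply/uniform_cvgP => e e_gt0.
apply: filterS ((uniform_cvgP _ _ _).1 dws_g e e_gt0) => n hn z xz.
by have /@derive_val -> := w_dz z xz; exact: hn.
Qed.

End LocallyUniformConvergence.

Section LimitsOfHarmonicFunctions.
Context {R : realType}.
Local Notation P := (R * R)%type.
Implicit Types (u : P -> R) (us : nat -> P -> R) (x v w z : P) (D : set P) (r M : R).

Lemma weak_harmonic_derive_le u x r M v z : 0 < r ->
  weak_harmonic (ball x r) u -> (forall y, ball x r y -> `|u y| <= M) ->
  ball x (r / 2) z -> derivable u z v -> `|'D_v u z| <= 8 * M / r * `|v|.
Proof.
move=> r_gt0 hu u_le xz u_der; apply: (derive_le_lipschitz u_der).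
apply: filterS (nbhs_ball_mem xz) => y xy.
exact: weak_harmonic_lipschitz hu u_le xy xz.
Qed.

Lemma weak_harmonic_derive_lipschitz u x r M v y z : 0 < r ->
  weak_harmonic (ball x r) u -> (forall y, ball x r y -> `|u y| <= M) ->
  ball x (r / 8) y -> ball x (r / 8) z -> derivable u y v -> derivable u z v ->
  `|'D_v u y - 'D_v u z| <= 256 * M / r ^+ 2 * `|v| * `|y - z|.
Proof.
move=> r_gt0 hu u_le xy xz y_der z_der.
apply: (cvgr_to_le (cvg_norm (cvgB y_der z_der))).
near=> h.
have h_neq0 : h != 0 by near: h; exact: nbhs_dnbhs_neq.
have hv_lt : `|h *: v| < r / 4.
  by near: h; apply: near0_norm_scale_lt; rewrite divr_gt0.
rewrite !fctE -scalerBr normrZ normfV ler_pdivrMl ?normr_gt0 //.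
have -> : `|h| * (256 * M / r ^+ 2 * `|v| * `|y - z|) =
    256 * M / r ^+ 2 * `|h *: v| * `|y - z| by rewrite normrZ; ring.
rewrite /= [h *: v + y]addrC [h *: v + z]addrC.
exact: weak_harmonic_double_difference_le hu u_le hv_lt xy xz.
Unshelve. all: by end_near. Qed.

Lemma weak_harmonic_derive2_le u x r M v w z : 0 < r ->
  weak_harmonic (ball x r) u -> (forall y, ball x r y -> `|u y| <= M) ->
  (forall y, ball x (r / 8) y -> derivable u y v) ->
  ball x (r / 8) z -> derivable ('D_v u) z w ->
  `|'D_w ('D_v u) z| <= 256 * M / r ^+ 2 * `|v| * `|w|.
Proof.
move=> r_gt0 hu u_le u_der xz du_der; apply: (derive_le_lipschitz du_der).
apply: filterS (nbhs_ball_mem xz) => y xy.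
exact: (weak_harmonic_derive_lipschitz r_gt0 hu u_le xy xz (u_der y xy) (u_der z xz)).
Qed.

Lemma uniform_cauchy_derive us x r v : 0 < r ->
  (forall n, weak_harmonic (ball x r) (us n)) ->
  (forall n y, ball x r y -> derivable (us n) y v) ->
  uniform_cauchy (ball x r) us ->
  uniform_cauchy (ball x (r / 2)) (fun n => 'D_v (us n)).
Proof.
move=> r_gt0 hus us_der; have half_sub : ball x (r / 2) `<=` ball x r.
  by apply: le_ball; lra.
apply: (@uniform_cauchy_le _ _ _ _ _ _ (8 / r * `|v|)).
  by rewrite mulr_ge0 ?divr_ge0 // ltW.
move=> m n M _ us_le z xz.
have [dm dn] := (us_der m _ (half_sub _ xz), us_der n _ (half_sub _ xz)).
rewrite -deriveB // mulrAC [8 / r * M]mulrAC.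
exact: (weak_harmonic_derive_le r_gt0 (weak_harmonicB (hus m) (hus n)) us_le xz
  (derivableB dm dn)).
Qed.

Lemma uniform_cauchy_derive2 us x r v w : 0 < r ->
  (forall n, weak_harmonic (ball x r) (us n)) ->
  (forall n y, ball x r y -> derivable (us n) y v) ->
  (forall n y, ball x r y -> derivable ('D_v (us n)) y w) ->
  uniform_cauchy (ball x r) us ->
  uniform_cauchy (ball x (r / 8)) (fun n => 'D_w ('D_v (us n))).
Proof.
move=> r_gt0 hus us_der dus_der.
have eighth_sub : ball x (r / 8) `<=` ball x r by apply: le_ball; lra.
apply: (@uniform_cauchy_le _ _ _ _ _ _ (256 / r ^+ 2 * `|v| * `|w|)).
  by rewrite -mulrA mulr_ge0 ?divr_ge0 ?sqr_ge0 ?ler0n // mulr_ge0.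
move=> m n M _ us_le z xz.
have [dm dn] := (dus_der m _ (eighth_sub _ xz), dus_der n _ (eighth_sub _ xz)).
have dB : {near z, 'D_v (us m) - 'D_v (us n) =1 'D_v (us m - us n)}.
  apply: filterS (nbhs_ball_mem xz) => y /eighth_sub xy; symmetry.
  exact: (deriveB (us_der m y xy) (us_der n y xy)).
rewrite -deriveB // (near_eq_derive _ dB).
have -> : 256 / r ^+ 2 * `|v| * `|w| * M = 256 * M / r ^+ 2 * `|v| * `|w| by ring.
apply: (weak_harmonic_derive2_le r_gt0 (weak_harmonicB (hus m) (hus n)) us_le _ xz).
  by move=> y xy; apply: derivableB; apply/us_der/eighth_sub.
exact: near_eq_derivable dB (derivableB dm dn).
Qed.

Lemma C1_on_locally_uniform D us u : (forall n, C1_on D (us n)) ->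
  locally_uniform_cvg D us u ->
  (forall b, locally_uniform_cauchy D (fun n => 'D_(axis b) (us n))) ->
  C1_on D u /\
  forall b, locally_uniform_cvg D (fun n => 'D_(axis b) (us n)) ('D_(axis b) u).
Proof.
move=> C1us us_u dus_c.
have dus b := locally_uniform_derive
  (fun n => let: And3 _ us_der _ := (C1_onP _ _).1 (C1us n) in us_der b) us_u (dus_c b).
split; last by move=> b; case: (dus b).
apply/C1_onP; split; last 1 first.
- move=> b; have [_ dus_du] := dus b; apply: locally_uniform_cvg_continuous dus_du => n.
  by have [_ _] := (C1_onP _ _).1 (C1us n); exact.
- apply: locally_uniform_cvg_continuous us_u => n.
  by have [] := (C1_onP _ _).1 (C1us n).
by move=> b; case: (dus b).
Qed.

Lemma harmonic_on_locally_uniform D us u : open D -> (forall n, harmonic_on D (us n)) ->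
  locally_uniform_cvg D us u -> harmonic_on D u.
Proof.
move=> oD hus us_u; have us_c := locally_uniform_cvg_cauchy us_u.
have wus n := harmonic_on_weak_harmonic oD (hus n).
have C2us n := (C2_onP _ _).1 (hus n).1.
have us_der b n x : D x -> derivable (us n) x (axis b).
  by have /C1_onP[_ + _] := (C2us n).1; exact.
have dus_der b c n x : D x -> derivable ('D_(axis b) (us n)) x (axis c).
  by have /C1_onP[_ + _] := (C2us n).2 b; exact.
have dus_c b : locally_uniform_cauchy D (fun n => 'D_(axis b) (us n)).
  move=> x /us_c[r r_gt0 [rD us_cr]]; exists (r / 2); first by rewrite divr_gt0.
  split; first by apply: subset_trans rD; apply: le_ball; lra.
  apply: uniform_cauchy_derive us_cr => // n; first exact: sub_weak_harmonic (wus n).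
  by move=> y /rD; exact: us_der.
have d2us_c b c : locally_uniform_cauchy D (fun n => 'D_(axis c) ('D_(axis b) (us n))).
  move=> x /us_c[r r_gt0 [rD us_cr]]; exists (r / 8); first by rewrite divr_gt0.
  split; first by apply: subset_trans rD; apply: le_ball; lra.
  apply: uniform_cauchy_derive2 us_cr => // n; first exact: sub_weak_harmonic (wus n).
    by move=> y /rD; exact: us_der.
  by move=> y /rD; exact: dus_der.
have [C1u dus_du] := C1_on_locally_uniform (fun n => (C2us n).1) us_u dus_c.
have C1du b := C1_on_locally_uniform (fun n => (C2us n).2 b) (dus_du b) (d2us_c b).
split; first by apply/C2_onP; split; [exact: C1u|move=> b; case: (C1du b)].
move=> x Dx; rewrite laplacianE.
have lim b : (fun n => 'D_(axis b) ('D_(axis b) (us n)) x) @ \oo -->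
    'D_(axis b) ('D_(axis b) u) x.
  exact: locally_uniform_cvg_ptws ((C1du b).2 b) Dx.
have <- := cvg_lim (@Rhausdorff R) (cvgD (lim true) (lim false)).
apply/cvg_lim; first exact: Rhausdorff.
by apply: cvg_near_cst; apply: nearW => n; rewrite -[RHS]((hus n).2 x Dx) laplacianE.
Qed.

Lemma harnack_principle D us x : open D -> connected D -> D x ->
  (forall n, weak_harmonic D (us n)) ->
  (forall n z, D z -> us n z <= us n.+1 z) -> has_ubound (range (us ^~ x)) ->
  locally_uniform_cvg D us (fun z => limn (us ^~ z)).
Proof.
move=> oD cD Dx hus us_incr us_ub.
have us_le z : D z -> {homo us ^~ z : n m / (n <= m)%N >-> n <= m}.
  by move=> Dz; apply/nondecreasing_seqP => n; exact: us_incr.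
have us_x : uniform_cauchy [set x] us.
  apply: (@uniform_cvg_cauchy _ _ _ _ (fun=> sup (range (us ^~ x)))).
  by rewrite uniform_set1; exact: nondecreasing_cvgn (us_le x Dx) us_ub.
move=> y Dy; have [C [r [C_ge0 r_gt0 rD harnack_y]]] := harnack_ball oD cD Dx Dy.
exists r => //; split; first exact: rD.
apply: uniform_cauchy_cvg; apply: (uniform_cauchy_le C_ge0 _ us_x).
move=> m n M nm us_M z yz; have diff_ge0 a : D a -> 0 <= (us m - us n) a.
  by move=> Da; rewrite subr_ge0; exact: us_le.
have := harnack_y z yz _ (weak_harmonicB (hus m) (hus n)) diff_ge0.
rewrite ger0_norm ?(diff_ge0 _ (rD _ yz)) // => /le_trans; apply.
exact: (ler_wpM2l C_ge0 (le_trans (ler_norm _) (us_M x erefl))).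
Qed.

Lemma harnack_cvg0 D us x : open D -> connected D -> D x ->
  (forall n, weak_harmonic D (us n)) -> (forall n z, D z -> 0 <= us n z) ->
  us ^~ x @ \oo --> (0 : R) -> locally_uniform_cvg D us (cst 0).
Proof.
move=> oD cD Dx hus us_ge0 us_x0 y Dy.
have [C [r [C_ge0 r_gt0 rD harnack_y]]] := harnack_ball oD cD Dx Dy.
exists r => //; split; first exact: rD.
have Cus0 : C * us n x @[n --> \oo] --> (0 : R).
  by rewrite -(mulr0 C); exact: cvgM (cvg_cst C) us_x0.
apply/uniform_cvgP => e e_gt0; move/cvgr0Pnorm_le : Cus0 => /(_ _ e_gt0).
apply: filterS => n Cus_le z yz; rewrite subr0 ger0_norm ?us_ge0 //; last exact: rD.
by rewrite (le_trans (harnack_y z yz _ (hus n) (us_ge0 n))) // (le_trans (ler_norm _)).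
Qed.

End LimitsOfHarmonicFunctions.

Section CompactFacts.
Context {T : topologicalType} {R : realType}.
Implicit Types (K : set T) (h : nat -> T -> R) (c : R).

Lemma compact_nondecreasing_gt K h c : compact K ->
  (forall n, {within K, continuous (h n)}) ->
  (forall y, K y -> {homo h ^~ y : n m / (n <= m)%N >-> n <= m}) ->
  (forall y, K y -> exists n, c < h n y) ->
  exists n, forall y, K y -> c < h n y.
Proof.
move=> cK ch h_incr h_gt.
have /near_covering_withinP := (compact_near_coveringP K).1 cK.
move=> /(_ nat \oo (fun n y => c < h n y) _)[y Ky|N _ hN]; last first.
  by exists N => y; exact: hN (leqnn N) y.
have [n c_lt] := h_gt y Ky.
have near_gt : \forall z \near within K (nbhs y), c < h n z.
  by apply: cvgr_gt _ c_lt; move: (ch n) => /subspace_continuousP; exact.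
exists ([set z | K z -> c < h n z], [set m | (n <= m)%N]) => /=.
  by split; [exact: near_gt|exists n].
by move=> [z m] /= [c_lt_z nm] Kz; exact: lt_le_trans (c_lt_z Kz) (h_incr z Kz n m nm).
Qed.

End CompactFacts.

Section ExtendedReals.
Context {R : realType}.
Implicit Types (l u : \bar R).

Lemma adde_ge0_of_oppe_le u l : (-oo < u)%E -> (-oo < l)%E -> (- l <= u)%E ->
  (u +? l)%E /\ (0 <= u + l)%E.
Proof.
case: u l => [u||] [l||] //= _ _; rewrite ?leey // -EFinD !lee_fin => opp_le.
by split=> //; lra.
Qed.

Lemma ereal_squeeze l u : (l <= u)%E ->
  (forall e : R, 0 < e ->
    exists a b : R, [/\ (a%:E <= l)%E, (u <= b%:E)%E & b - a <= e]) ->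
  exists r : R, u = r%:E /\ l = r%:E.
Proof.
move=> lu small; have [a [b [al ub _]]] := small 1 ltr01.
case: l u => [l||] [u||] // in lu al ub small *.
exists u; split=> //; congr EFin; apply/eqP; rewrite eq_le -lee_fin lu /=.
apply/ler_addgt0Pr => e /small[a' [b' [+ +]]]; rewrite !lee_fin; lra.
Qed.

End ExtendedReals.

Section DirichletIntegral.
Context {R : realType}.
Local Notation P := (R * R)%type.
Implicit Types (g : P -> R) (gs : nat -> P -> R) (f : P -> \bar R) (x y : P).

Lemma compact_closure_bounded (A : set P) (M : R) :
  (forall x, A x -> `|x| <= M) -> compact (closure A).
Proof.
move=> A_le; apply: (@subclosed_compact _ _ (cball 0 M)).
- exact: closed_closure.
- exact: compact_cball.
rewrite [X in _ `<=` X](closure_id _).1; last exact: closed_closed_ball_.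
by apply: closure_subset => x /A_le; rewrite /closed_ball_ /= sub0r normrN.
Qed.

Context (D : set P) (openD : open D) (compactD : compact (closure D)).

Lemma compact_bdry : compact (bdry D).
Proof.
apply: subclosed_compact compactD _; last by move=> x [].
by apply: closedI; [exact: closed_closure|exact: open_closedC].
Qed.

Lemma weak_harmonic_ge_bdry (w : P -> R) (m : R) : weak_harmonic D w ->
  {within closure D, continuous w} -> (forall y, bdry D y -> m <= w y) ->
  forall y, D y -> m <= w y.
Proof.
move=> hw cw m_le y Dy; suff : (- w) y <= - m by rewrite lerN2.
apply: (max_principle compactD) (subset_closure Dy).
  by move=> z; apply: cvgN (cw z).
move=> z clDz; have [Dz|nDz] := pselect (D z).
  right; split; last by exists 0 => //; exact: (weak_harmonicN hw Dz).2.
  by apply: filterS (open_nbhs_nbhs (conj openD Dz)); exact: subset_closure.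
by left; rewrite lerN2; exact: m_le.
Qed.

Definition majorizing_seq f : set (nat -> P -> R) := [set gs | incr_seq D gs /\
  exists2 phi : P -> \bar R,
    (forall y, bdry D y -> (gs n y)%:E @[n --> \oo] --> phi y) &
    forall y, bdry D y -> (f y <= phi y)%E].

Lemma upper_intE (I : (P -> R) -> R) f : upper_int D I f =
  ereal_inf [set limn (fun n => (I (gs n))%:E) | gs in majorizing_seq f].
Proof.
congr ereal_inf; apply/seteqP; split=> l.
  move=> [gs [phi [gs_incr gs_phi phi_ge ->]]]; exists gs => //.
  by split=> //; exists phi.
by move=> [gs [gs_incr [phi gs_phi phi_ge]] <-]; exists gs, phi.
Qed.

Lemma majorizing_seq_homo f gs y : majorizing_seq f gs -> bdry D y ->
  {homo gs ^~ y : n m / (n <= m)%N >-> n <= m}.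
Proof. by move=> [[_ gs_le] _] bdy; apply/nondecreasing_seqP => n; exact: gs_le. Qed.

Lemma majorizing_pair_gt f gs hs (e : R) y : 0 < e -> majorizing_seq f gs ->
  majorizing_seq (fun z => - f z)%E hs -> bdry D y -> exists n, - e < gs n y + hs n y.
Proof.
move=> e_gt0 gsf hsf bdy.
have [[_ [phi gs_phi f_le]] [_ [psi hs_psi f_ge]]] := (gsf, hsf).
have limit_gtNy (ks : nat -> P -> R) (k : \bar R) :
    {homo ks ^~ y : n m / (n <= m)%N >-> n <= m} ->
    (ks n y)%:E @[n --> \oo] --> k -> (-oo < k)%E.
  move=> ks_le ks_k; apply: lt_le_trans (ltNyr (ks 0%N y)) _.
  by apply: (cvge_to_ge ks_k); apply: nearW => n; rewrite lee_fin; exact: ks_le.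
have phi_gt := limit_gtNy _ _ (majorizing_seq_homo gsf bdy) (gs_phi y bdy).
have psi_gt := limit_gtNy _ _ (majorizing_seq_homo hsf bdy) (hs_psi y bdy).
have opp_le : (- psi y <= phi y)%E.
  by apply: le_trans (f_le y bdy); rewrite leeNl; exact: f_ge.
have [sum_def sum_ge0] := adde_ge0_of_oppe_le phi_gt psi_gt opp_le.
have [//|/forallNP sum_le] := pselect (exists n, - e < gs n y + hs n y).
suff /(le_trans sum_ge0) : (phi y + psi y <= (- e)%:E)%E by rewrite lee_fin; lra.
apply: (cvge_to_le (cvgeD sum_def (gs_phi y bdy) (hs_psi y bdy))); apply: nearW => n.
by rewrite -EFinD lee_fin leNgt; apply/negP.
Qed.

Lemma majorizing_pair_ge f gs hs (e : R) : 0 < e -> majorizing_seq f gs ->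
  majorizing_seq (fun z => - f z)%E hs ->
  exists n, forall y, bdry D y -> - e <= gs n y + hs n y.
Proof.
move=> e_gt0 gsf hsf.
have [n sum_gt] : exists n, forall y, bdry D y -> - e < (gs n + hs n) y.
  apply: (compact_nondecreasing_gt (h := fun n => gs n + hs n) compact_bdry).
  - by move=> n; exact: within_continuousD (gsf.1.1 n) (hsf.1.1 n).
  - move=> y bdy n m nm.
    exact: lerD (majorizing_seq_homo gsf bdy nm) (majorizing_seq_homo hsf bdy nm).
  - by move=> y; exact: (majorizing_pair_gt e_gt0 gsf hsf).
by exists n => y /sum_gt/ltW.
Qed.

Context (U : (P -> R) -> P -> R) (hU : forall g, Cbd D g -> dirichlet_sol D g (U g)).

Lemma weak_harmonic_sol g : Cbd D g -> weak_harmonic D (U g).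
Proof. by move=> /hU[/(harmonic_on_weak_harmonic openD)]. Qed.

Lemma continuous_sol g : Cbd D g -> {within closure D, continuous (U g)}.
Proof. by move=> /hU[_ []]. Qed.

Lemma sol_bdry g y : Cbd D g -> bdry D y -> U g y = g y.
Proof. by move=> /hU[_ [_]]; exact. Qed.

Lemma sol_le g h y : Cbd D g -> Cbd D h ->
  (forall z, bdry D z -> g z <= h z) -> D y -> U g y <= U h y.
Proof.
move=> cg ch gh Dy; rewrite -subr_ge0.
apply: (@weak_harmonic_ge_bdry (U h - U g)) Dy.
- exact: weak_harmonicB (weak_harmonic_sol ch) (weak_harmonic_sol cg).
- exact: within_continuousB (continuous_sol ch) (continuous_sol cg).
- move=> z bz; rewrite -[(U h - U g) z]/(U h z - U g z) subr_ge0.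
  by rewrite !sol_bdry //; exact: gh.
Qed.

Lemma solD_ge g h (m : R) y : Cbd D g -> Cbd D h ->
  (forall z, bdry D z -> m <= g z + h z) -> D y -> m <= U g y + U h y.
Proof.
move=> cg ch m_le Dy; apply: (@weak_harmonic_ge_bdry (U g + U h)) Dy.
- exact: weak_harmonicD (weak_harmonic_sol cg) (weak_harmonic_sol ch).
- exact: within_continuousD (continuous_sol cg) (continuous_sol ch).
- by move=> z bz; rewrite -[(U g + U h) z]/(U g z + U h z) !sol_bdry //; exact: m_le.
Qed.

Lemma sol_homo f gs y : majorizing_seq f gs -> D y ->
  {homo (fun n => U (gs n) y) : n m / (n <= m)%N >-> n <= m}.
Proof.
move=> [[cgs gs_le] _] Dy; apply/nondecreasing_seqP => n.
by apply: sol_le => // z; exact: gs_le.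
Qed.

Lemma limn_sol f gs y : majorizing_seq f gs -> D y ->
  limn (fun n => (U (gs n) y)%:E) = ereal_sup (range (fun n => (U (gs n) y)%:E)).
Proof.
move=> gsf Dy; apply/cvg_lim => //; apply: ereal_nondecreasing_cvgn => n m nm.
by rewrite lee_fin (sol_homo gsf Dy).
Qed.

Local Notation upper y f := (upper_int D (fun g => U g y) f).
Local Notation lower y f := (lower_int D (fun g => U g y) f).

Lemma upper_int_le f gs y (a : R) : majorizing_seq f gs -> D y ->
  (forall n, U (gs n) y <= a) -> (upper y f <= a%:E)%E.
Proof.
move=> gsf Dy gs_le; rewrite upper_intE.
apply: (@le_trans _ _ (limn (fun n => (U (gs n) y)%:E))).
  by apply: ereal_inf_lbound; exists gs.
by rewrite (limn_sol gsf Dy); apply: ge_ereal_sup => _ [n _ <-]; rewrite lee_fin.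
Qed.

Lemma lower_int_le_upper_int f y : D y -> (lower y f <= upper y f)%E.
Proof.
move=> Dy; rewrite /lower_int !upper_intE.
apply: le_ereal_inf_tmp => _ [gs gsf <-]; rewrite leeNl.
apply: le_ereal_inf_tmp => _ [hs hsf <-].
rewrite (limn_sol gsf Dy) (limn_sol hsf Dy) leeNl.
apply/lee_addgt0Pr => e e_gt0.
have [n hn] := majorizing_pair_ge e_gt0 gsf hsf.
have sum_ge := solD_ge (gsf.1.1 n) (hsf.1.1 n) hn Dy.
apply: (@le_trans _ _ (- (U (hs n) y)%:E)%E).
  by rewrite leeN2; apply: ereal_sup_ubound; exists n.
apply: (@le_trans _ _ ((U (gs n) y)%:E + e%:E)%E).
  by rewrite -EFinN -EFinD lee_fin; lra.
by rewrite leeD2r //; apply: ereal_sup_ubound; exists n.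
Qed.

Context (connD : connected D) (x : P) (Dx : D x).

Lemma harmonic_majorant f (c : R) : (upper x f < c%:E)%E ->
  exists2 a : P -> R, harmonic_on D a /\ a x <= c &
    forall y, D y -> (upper y f <= (a y)%:E)%E.
Proof.
rewrite upper_intE => /ereal_inf_lt[_ [gs gsf <-]].
rewrite (limn_sol gsf Dx) => /ltW sup_le.
have sol_le_c n : U (gs n) x <= c.
  by rewrite -lee_fin (le_trans _ sup_le) //; apply: ereal_sup_ubound; exists n.
have cgs n : Cbd D (gs n) := gsf.1.1 n.
have sol_cvg : locally_uniform_cvg D (fun n => U (gs n))
    (fun y => limn (fun n => U (gs n) y)).
  apply: harnack_principle openD connD Dx _ _ _.
  - by move=> n; exact: weak_harmonic_sol.
  - by move=> n y Dy; exact: (sol_homo gsf Dy (leqnSn n)).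
  - by exists c => _ [n _ <-].
have cvg_at y (Dy : D y) := locally_uniform_cvg_ptws sol_cvg Dy.
exists (fun y => limn (fun n => U (gs n) y)).
  split; last by apply: (cvgr_to_le (cvg_at x Dx)); exact: nearW.
  by apply: harmonic_on_locally_uniform sol_cvg => // n; case: (hU (cgs n)).
move=> y Dy; apply: (upper_int_le gsf Dy) => n.
apply: (nondecreasing_cvgn_le (sol_homo gsf Dy)).
by apply/cvg_ex; eexists; exact: cvg_at.
Qed.

Lemma harmonic_bracket f (e : R) : integrable_D D (fun g => U g x) f -> 0 < e ->
  exists a b : P -> R, [/\ harmonic_on D a, harmonic_on D b, a x + b x <= e &
    forall y, D y -> ((- b y)%:E <= lower y f)%E /\ (upper y f <= (a y)%:E)%E].
Proof.
move=> [r [upper_r lower_r]] e_gt0.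
have upper_lt : (upper x f < (r + e / 2)%:E)%E.
  by rewrite upper_r lte_fin ltrDl divr_gt0.
have upperN_lt : (upper x (fun y => - f y)%E < (- r + e / 2)%:E)%E.
  rewrite -[upper_int _ _ _]oppeK -/(lower x f) lower_r.
  by rewrite -EFinN lte_fin ltrDl divr_gt0.
have [a [ha ax] upper_le] := harmonic_majorant upper_lt.
have [b [hb bx] upperN_le] := harmonic_majorant upperN_lt.
exists a, b; split=> //; first lra.
by move=> y Dy; split; [rewrite EFinN leeN2; exact: upperN_le|exact: upper_le].
Qed.

Lemma harmonic_bracket_seq f : integrable_D D (fun g => U g x) f ->
  exists A B : nat -> P -> R, [/\ forall n, harmonic_on D (A n),
    locally_uniform_cvg D (fun n => A n + B n) (cst 0) &
    forall n y, D y -> ((- B n y)%:E <= lower y f)%E /\ (upper y f <= (A n y)%:E)%E].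
Proof.
move=> intf.
have inv_gt0 n : 0 < n.+1%:R^-1 :> R by rewrite invr_gt0.
have /choice[A] := fun n => harmonic_bracket intf (inv_gt0 n).
move=> /choice[B AB]; exists A, B; split; first by move=> n; case: (AB n).
  have sum_ge0 n y : D y -> 0 <= (A n + B n) y.
    move=> Dy; have [_ _ _ /(_ y Dy)[lo up]] := AB n.
    have := le_trans lo (le_trans (lower_int_le_upper_int f Dy) up).
    by rewrite lee_fin -subr_ge0 opprK.
  apply: (harnack_cvg0 openD connD Dx _ sum_ge0).
    move=> n; have [hA hB _ _] := AB n.
    by apply: weak_harmonicD; exact: harmonic_on_weak_harmonic.
  apply: (squeeze_cvgr _ (cvg_cst 0) cvg_harmonic).
  by apply: nearW => n; rewrite sum_ge0 //=; case: (AB n).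
by move=> n y Dy; case: (AB n) => _ _ _; exact.
Qed.

End DirichletIntegral.

Unset Implicit Arguments.

Theorem mainTheorem20 (R : realType) (D : set (R * R))
  (hopen : open D) (hconn : connected D)
  (hbdd : exists M : R, forall x, D x -> `|x.1| <= M /\ `|x.2| <= M)
  (U : (R * R -> R) -> (R * R -> R))
  (hU : forall g, Cbd D g -> dirichlet_sol D g (U g))
  (f : R * R -> \bar R) (x : R * R) (hx : D x)
  (hf : integrable_D D (fun g => U g x) f) :
  (forall y, D y -> integrable_D D (fun g => U g y) f) /\
  harmonic_on D (fun y => daniell D (fun g => U g y) f).
Proof.
have compactD : compact (closure D).
  have [M D_le] := hbdd; apply: (@compact_closure_bounded _ _ M) => z /D_le.
  by rewrite prod_norm_le => -[-> ->].
have [A [B [hA AB0 bracket]]] := harmonic_bracket_seq hopen compactD hU hconn hx hf.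
have integrable_at y : D y -> integrable_D D (fun g => U g y) f.
  move=> Dy; apply: ereal_squeeze; first exact: lower_int_le_upper_int.
  move=> e e_gt0; have /cvgr0Pnorm_le/(_ e e_gt0)[n _ /(_ n (leqnn n)) AB_le] :=
    locally_uniform_cvg_ptws AB0 Dy.
  have [lower_ge upper_le] := bracket n y Dy.
  exists (- B n y), (A n y); split=> //.
  by rewrite opprK; exact: le_trans (ler_norm _) AB_le.
split=> //; apply: (harmonic_on_locally_uniform hopen hA).
apply: (locally_uniform_cvg_squeeze AB0) => n z Dz.
have [r [upper_r lower_r]] := integrable_at z Dz; have := bracket n z Dz.
rewrite /daniell upper_r lower_r !lee_fin /= ler_distl !fctE; lra.
Qed.
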